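(* Let $\mathcal{F}_J$ be the Jouanolou foliation of degree $2$ on $\mathbb{P}^2(\mathbb{C})$, let $\mathcal{I}_{\mathcal{F}_J}$ be the birational involution associated to it, and let $\mathrm{Iso}(\mathcal{F}_J)$ be its isotropy group. Then $\mathcal{I}_{\mathcal{F}_J}$ is of Geiser type. Moreover, the group generated by $\mathcal{I}_{\mathcal{F}_J}$ and $\mathrm{Iso}(\mathcal{F}_J)$ is a finite subgroup of order $42$ of the Cremona group $\mathrm{Bir}(\mathbb{P}^2(\mathbb{C}))$, and it is not linearizable.
   Context: The foliation $\mathcal{F}_J$ is the degree $2$ foliation of $\mathbb{P}^2(\mathbb{C})$ defined in the affine chart $z=1$ by the vector field $(x^3-y^2)\frac{\partial}{\partial x}+(x^2y-1)\frac{\partial}{\partial y}$. The degree of a foliation on $\mathbb{P}^2(\mathbb{C})$ is the number of its tangency points with a generic line. If $\mathcal{F}$ is a foliation of degree $2$ and $m$ is a generic point, the tangent line at $m$ to the leaf through $m$ is tangent to $\mathcal{F}$ at exactly one second point $m'$; the involution associated to $\mathcal{F}$ is the birational involution $\mathcal{I}_{\mathcal{F}}:m\mapsto m'$. The isotropy group is $\mathrm{Iso}(\mathcal{F})=\{\varphi\in\mathrm{Aut}(\mathbb{P}^2(\mathbb{C}))\mid\varphi^*\mathcal{F}=\mathcal{F}\}$. Geiser involution: let $p_1,\ldots,p_7\in\mathbb{P}^2(\mathbb{C})$ be in general position (no three collinear, no six on a conic). For a generic point $p$, the cubics through $p_1,\ldots,p_7$ and $p$ form a pencil with nine base points: $p_1,\dots,p_7$,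 $p$ and a ninth one $\mathcal{I}_G(p)$; the birational involution $p\mapsto\mathcal{I}_G(p)$ is called a Geiser involution. A birational involution is of Geiser type if it is conjugate in $\mathrm{Bir}(\mathbb{P}^2(\mathbb{C}))$ to a Geiser involution. A subgroup of $\mathrm{Bir}(\mathbb{P}^2(\mathbb{C}))$ is linearizable if it is conjugate, by a birational transformation of $\mathbb{P}^2(\mathbb{C})$, to a subgroup of $\mathrm{Aut}(\mathbb{P}^2(\mathbb{C}))$. *)

(* Defs.v *)
From HB Require Import structures.
From mathcomp Require Import all_boot all_order all_algebra.
From mathcomp Require Import ring.
From mathcomp Require Import boolp classical_sets cardinality reals.
From mathcomp Require Import complex mpoly.

Set Implicit Arguments.
Unset Strict Implicit.
Unset Printing Implicit Defensive.

Import GRing.Theory.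

Local Open Scope ring_scope.
Local Open Scope quotient_scope.
Local Open Scope classical_set_scope.

Section RationalMaps.
Variable K : fieldType.

(* A triple (f_0, f_1, f_2) of forms of the same degree, not all zero, stands
   for the rational map [x : y : z] |-> [f_0 : f_1 : f_2] of the plane.  The
   f_i may have a common factor: two triples define the same rational map iff
   they are proportional over the field of rational functions. *)
Definition triple := 3.-tuple {mpoly K[3]}.

Definition homog_nz (f : triple) : bool :=
  [exists i, tnth f i != 0] &&
  `[< exists d : nat, forall i, tnth f i \is d.-homog >].

Definition proportional (f g : triple) : bool :=
  [forall i, forall j, tnth f i * tnth g j == tnth f j * tnth g i].

Definition same_map (f g : triple) : bool :=
  [&& homog_nz f, homog_nz g & proportional f g].

Definition comp_triple (f g : triple) : triple :=
  [tuple tnth f i \mPo g | i < 3].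

Definition id_triple : triple := [tuple 'X_i | i < 3].

Definition birational_pair (f g : triple) : bool :=
  [&& homog_nz f, homog_nz g,
      same_map (comp_triple f g) id_triple &
      same_map (comp_triple g f) id_triple].

Local Notation "f \o3 g" := (comp_triple f g) (at level 40, left associativity).

Lemma proportionalP f g :
  reflect (forall i j, tnth f i * tnth g j = tnth f j * tnth g i)
          (proportional f g).
Proof.
by apply: (iffP forallP) => h i; [move=> j; move/forallP/(_ j)/eqP: (h i) |
  apply/forallP => j; apply/eqP].
Qed.

Lemma proportional_refl f : proportional f f.
Proof. by apply/proportionalP => i j; rewrite mulrC. Qed.

Lemma proportional_sym f g : proportional f g = proportional g f.
Proof.
by apply/proportionalP/proportionalP => h i j; rewrite mulrC -h mulrC.
Qed.

Lemma homog_nzP f : reflect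
  ((exists i, tnth f i != 0) /\
   (exists d : nat, forall i, tnth f i \is d.-homog)) (homog_nz f).
Proof.
by apply: (iffP andP) => -[a b]; split; by [apply/existsP | apply/asboolP].
Qed.

Lemma proportional_trans g f h : homog_nz g ->
  proportional f g -> proportional g h -> proportional f h.
Proof.
move=> /homog_nzP[[k nzk] _] /proportionalP fg /proportionalP gh.
apply/proportionalP => i j; apply: (mulfI nzk).
have e1 := fg i k; have e2 := gh i j; have e3 := fg j k.
rewrite mulrA (mulrC _ (tnth f i)) e1 -mulrA e2 mulrA -e3.
by rewrite (mulrC (tnth f j)) mulrA.
Qed.

Lemma comp_tripleE f g i : tnth (f \o3 g) i = tnth f i \mPo g.
Proof. by rewrite tnth_mktuple. Qed.

Lemma id_tripleE i : tnth id_triple i = 'X_i.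
Proof. by rewrite tnth_mktuple. Qed.

Lemma comp_mpolyXt (g : triple) i : 'X_i \mPo g = tnth g i.
Proof. by rewrite comp_mpolyXU (tnth_nth 0). Qed.

Lemma comp_id_triple f : f \o3 id_triple = f.
Proof. by apply: eq_from_tnth => i; rewrite comp_tripleE comp_mpoly_id. Qed.

Lemma id_comp_triple f : id_triple \o3 f = f.
Proof.
by apply: eq_from_tnth => i; rewrite comp_tripleE id_tripleE comp_mpolyXt.
Qed.

Lemma comp_mpolyA (p : {mpoly K[3]}) (g h : triple) :
  (p \mPo g) \mPo h = p \mPo (g \o3 h).
Proof.
rewrite (comp_mpolyE p g) (comp_mpolyE p (g \o3 h)) raddf_sum /=.
apply: eq_bigr => m _; rewrite comp_mpolyZ rmorph_prod /=; congr (_ *: _).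
by apply: eq_bigr => i _; rewrite rmorphXn /= comp_tripleE.
Qed.

Lemma comp_tripleA f g h : f \o3 (g \o3 h) = (f \o3 g) \o3 h.
Proof.
by apply: eq_from_tnth => i; rewrite !comp_tripleE comp_mpolyA.
Qed.

Lemma comp_mpoly_scale (p c : {mpoly K[3]}) d (g h : triple) :
  p \is d.-homog -> (forall i, tnth h i = c * tnth g i) ->
  p \mPo h = c ^+ d * (p \mPo g).
Proof.
move=> /dhomogP hp hE; rewrite !comp_mpolyE mulr_sumr [LHS]big_seq [RHS]big_seq.
apply: eq_bigr => m mp; rewrite -scalerAr; congr (_ *: _).
under eq_bigr => i _ do rewrite hE exprMn.
have <- : mdeg m = d by exact: hp.
by rewrite big_split /= prodrXr mdegE.
Qed.

Lemma comp_mpoly_homog (p : {mpoly K[3]}) d e (g : triple) :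
  p \is d.-homog -> (forall i, tnth g i \is e.-homog) ->
  p \mPo g \is (d * e).-homog.
Proof.
move=> /dhomogP hp hg; rewrite comp_mpolyE big_seq; apply: rpred_sum => m mp.
have <- : mdeg m = d by exact: hp.
apply: rpredZ; rewrite mdegE !big_ord_recl !big_ord0 /=.
by rewrite mulr1 addn0 !mulnDl !(mulnC _ e); do 2?[apply: dhomogM];
  apply: dhomogMn.
Qed.

Lemma comp_mpoly_prop (p : {mpoly K[3]}) d (g g' : triple) k :
  p \is d.-homog -> proportional g g' ->
  tnth g' k ^+ d * (p \mPo g) = tnth g k ^+ d * (p \mPo g').
Proof.
move=> hp /proportionalP gg'.
pose h : triple := [tuple tnth g' k * tnth g i | i < 3].
rewrite -(@comp_mpoly_scale p _ d g h hp); last by move=> i; rewrite tnth_mktuple.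
apply: comp_mpoly_scale => // i; rewrite tnth_mktuple.
by rewrite mulrC gg'.
Qed.

Lemma prop_nz g g' k : homog_nz g' -> proportional g g' ->
  tnth g k != 0 -> tnth g' k != 0.
Proof.
move=> /homog_nzP[[l nzl] _] /proportionalP gg' nzk.
apply/eqP => g'k0; have /eqP := gg' k l.
by rewrite g'k0 mulr0 mulf_eq0 (negbTE nzk) (negbTE nzl).
Qed.

Lemma prop_compl f f' g : proportional f f' -> proportional (f \o3 g) (f' \o3 g).
Proof.
move=> /proportionalP ff'; apply/proportionalP => i j.
by rewrite !comp_tripleE -!rmorphM /= ff'.
Qed.

Lemma prop_compr f g g' : homog_nz f -> homog_nz g -> homog_nz g' ->
  proportional g g' -> proportional (f \o3 g) (f \o3 g').
Proof.
move=> /homog_nzP[_ [d hf]] /homog_nzP[[k nzk] _] hg' gg'.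
have nzk' := prop_nz hg' gg' nzk.
apply/proportionalP => i j; rewrite !comp_tripleE.
apply: (mulfI (expf_neq0 d nzk')).
have ei := comp_mpoly_prop k (hf i) gg'; have ej := comp_mpoly_prop k (hf j) gg'.
by rewrite mulrA ei mulrA ej -mulrA -mulrA; congr (_ * _); exact: mulrC.
Qed.

Lemma homog_nz_id : homog_nz id_triple.
Proof.
apply/homog_nzP; split; first by exists ord0; rewrite id_tripleE -msize_poly_eq0 msizeX.
by exists 1%N => i; rewrite id_tripleE dhomogX; apply/eqP/mdeg1.
Qed.

Definition dominant (g : triple) : Prop := homog_nz g /\
  forall (p : {mpoly K[3]}) d, p \is d.-homog -> p \mPo g = 0 -> p = 0.

Lemma homog_nz_comp f g : homog_nz f -> dominant g -> homog_nz (f \o3 g).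
Proof.
move=> /homog_nzP[[i nzi] [d hf]] [/homog_nzP[_ [e hg]] domg].
apply/homog_nzP; split.
  exists i; rewrite comp_tripleE; apply: contra nzi => /eqP /domg.
  by move=> /(_ d (hf i)) ->.
by exists (d * e)%N => j; rewrite comp_tripleE; apply: comp_mpoly_homog.
Qed.

Lemma dominant_comp f g : dominant f -> dominant g -> dominant (f \o3 g).
Proof.
move=> [nzf domf] dg; split; first exact: homog_nz_comp.
move=> p d hp; rewrite -comp_mpolyA => p0; apply: (domf p d hp).
have /homog_nzP[_ [e hf]] := nzf.
exact: dg.2 (comp_mpoly_homog hp hf) p0.
Qed.

Lemma dominant_rinv f g : homog_nz f ->
  same_map (f \o3 g) id_triple -> dominant f.
Proof.
move=> nzf /and3P[fg_nz _ fg]; split=> // p d hp p0.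
have /homog_nzP[[k nzk] _] := fg_nz.
have := comp_mpoly_prop k hp fg.
rewrite -comp_mpolyA p0 comp_mpoly0 mulr0 comp_mpoly_id => /esym/eqP.
by rewrite mulf_eq0 expf_eq0 (negbTE nzk) andbF => /eqP.
Qed.

Lemma birational_pairP f g : reflect
  [/\ dominant f, dominant g, proportional (f \o3 g) id_triple &
      proportional (g \o3 f) id_triple] (birational_pair f g).
Proof.
apply: (iffP and4P) => [[nzf nzg fg gf]|[df dg fg gf]].
  split; [exact: dominant_rinv fg | exact: dominant_rinv gf | |].
    by case/and3P: fg.
  by case/and3P: gf.
split; [exact: df.1 | exact: dg.1 | |];
  by apply/and3P; split=> //; first [exact: homog_nz_id |
     apply: homog_nz_comp => //; first [exact: df.1 | exact: dg.1]].
Qed.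

Lemma birational_pair_id : birational_pair id_triple id_triple.
Proof.
have := homog_nz_id; have := proportional_refl id_triple.
by rewrite /birational_pair /same_map comp_id_triple => -> ->.
Qed.

Lemma birational_pair_sym f g : birational_pair f g -> birational_pair g f.
Proof. by case/birational_pairP=> *; apply/birational_pairP. Qed.

Lemma prop_comp_mid f g f' g' : dominant f -> dominant g ->
  dominant f' -> dominant g' ->
  proportional (f \o3 g) id_triple -> proportional (f' \o3 g') id_triple ->
  proportional (f \o3 f' \o3 (g' \o3 g)) id_triple.
Proof.
move=> df dg df' dg' fg fg'.
have d1 : dominant (f' \o3 g' \o3 g) :=
  dominant_comp (dominant_comp df' dg') dg.
have -> : f \o3 f' \o3 (g' \o3 g) = f \o3 (f' \o3 g' \o3 g).
  by rewrite !comp_tripleA.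
apply: (proportional_trans (dominant_comp df dg).1 _ fg).
apply: prop_compr; [exact: df.1 | exact: d1.1 | exact: dg.1 |].
by rewrite -[X in proportional _ X]id_comp_triple; apply: prop_compl.
Qed.

Lemma birational_pair_comp f g f' g' :
  birational_pair f g -> birational_pair f' g' ->
  birational_pair (f \o3 f') (g' \o3 g).
Proof.
move=> /birational_pairP[df dg fg gf] /birational_pairP[df' dg' fg' gf'].
apply/birational_pairP; split; try exact: dominant_comp.
  exact: prop_comp_mid.
exact: prop_comp_mid.
Qed.

Lemma birational_pair_inv f g f' g' :
  birational_pair f g -> birational_pair f' g' ->
  proportional f f' -> proportional g g'.
Proof.
move=> /birational_pairP[df dg fg gf] /birational_pairP[df' dg' fg' gf'] ff'.
have d1 := dominant_comp dg (dominant_comp df' dg').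
apply: (proportional_trans d1.1).
  rewrite proportional_sym -{2}(comp_id_triple g).
  apply: prop_compr => //; [exact: dg.1 | | exact: homog_nz_id].
  exact: (dominant_comp df' dg').1.
rewrite -{2}(id_comp_triple g') comp_tripleA; apply: prop_compl.
apply: (proportional_trans (dominant_comp dg df).1 _ gf).
apply: prop_compr; [exact: dg.1 | exact: df'.1 | exact: df.1 |].
by rewrite proportional_sym.
Qed.

End RationalMaps.

Arguments proportional : simpl never.
Arguments comp_triple : simpl never.
Arguments id_triple : simpl never.

Section Cremona.
Variable K : fieldType.

(* The second component only witnesses that the first one is birational; it
   is determined by the first one up to [proportional], and is ignored by
   [birational_eq]. *)
Definition birational :=
  {fg : triple K * triple K | birational_pair fg.1 fg.2}.

Definition birational_eq (f g : birational) : bool :=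
  proportional (val f).1 (val g).1.

Lemma birational_eq_refl : reflexive birational_eq.
Proof. by move=> f; apply: proportional_refl. Qed.

Lemma birational_eq_sym : ssrbool.symmetric birational_eq.
Proof. by move=> f g; apply: proportional_sym. Qed.

Lemma birational_eq_trans : transitive birational_eq.
Proof.
move=> g f h; apply: proportional_trans.
by have /birational_pairP[[]] := valP g.
Qed.

Canonical birational_equiv := EquivRel birational_eq
  birational_eq_refl birational_eq_sym birational_eq_trans.

(* Bir(P^2), with composition as group law: f * g is "g, then f". *)
Definition cremona := {eq_quot birational_eq}.
HB.instance Definition _ := Choice.on cremona.
HB.instance Definition _ := EqQuotient.on cremona.

Definition birational_id : birational :=
  exist _ (id_triple K, id_triple K) (birational_pair_id K).

Definition birational_inv (f : birational) : birational :=
  exist _ ((val f).2, (val f).1) (birational_pair_sym (valP f)).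

Definition birational_comp (f g : birational) : birational :=
  exist _ (comp_triple (val f).1 (val g).1, comp_triple (val g).2 (val f).2)
    (birational_pair_comp (valP f) (valP g)).

Definition cremona_id : cremona := \pi_cremona birational_id.
Definition cremona_inv (f : cremona) : cremona :=
  \pi_cremona (birational_inv (repr f)).
Definition cremona_comp (f g : cremona) : cremona :=
  \pi_cremona (birational_comp (repr f) (repr g)).

Lemma cremona_piE (f g : birational) :
  (\pi_cremona f = \pi_cremona g) <-> birational_eq f g.
Proof. by split=> [/eqmodP|h]; last apply/eqmodP. Qed.

Lemma repr_piE (f : birational) : birational_eq (repr (\pi_cremona f)) f.
Proof. by apply/cremona_piE; rewrite reprK. Qed.

Lemma pi_cremona_inv (f : birational) :
  cremona_inv (\pi_cremona f) = \pi_cremona (birational_inv f).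
Proof.
apply/cremona_piE.
by have := birational_pair_inv (valP (repr (\pi_cremona f))) (valP f)
  (repr_piE f).
Qed.

Lemma pi_cremona_comp (f g : birational) :
  cremona_comp (\pi_cremona f) (\pi_cremona g)
  = \pi_cremona (birational_comp f g).
Proof.
apply/cremona_piE; have ef := repr_piE f; have eg := repr_piE g.
set f' := repr _ in ef *; set g' := repr _ in eg *.
have /birational_pairP[df _ _ _] := valP f.
have /birational_pairP[dg _ _ _] := valP g.
have /birational_pairP[df' _ _ _] := valP f'.
have /birational_pairP[dg' _ _ _] := valP g'.
apply: (@proportional_trans _ (comp_triple (val f').1 (val g).1)).
- exact: (dominant_comp df' dg).1.
- by apply: prop_compr => //; [exact: df'.1 | exact: dg'.1 | exact: dg.1].
- exact: prop_compl.
Qed.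

Lemma cremona_compA : associative cremona_comp.
Proof.
elim/quotW=> f; elim/quotW=> g; elim/quotW=> h.
rewrite (pi_cremona_comp g h) (pi_cremona_comp f g).
rewrite (pi_cremona_comp f (birational_comp g h)).
rewrite (pi_cremona_comp (birational_comp f g) h); apply/cremona_piE.
by rewrite /birational_eq /= comp_tripleA proportional_refl.
Qed.

Lemma cremona_comp1f : left_id cremona_id cremona_comp.
Proof.
elim/quotW=> f; rewrite pi_cremona_comp; apply/cremona_piE.
by rewrite /birational_eq /= id_comp_triple proportional_refl.
Qed.

Lemma cremona_compf1 : right_id cremona_id cremona_comp.
Proof.
elim/quotW=> f; rewrite pi_cremona_comp; apply/cremona_piE.
by rewrite /birational_eq /= comp_id_triple proportional_refl.
Qed.

Lemma cremona_compVf : left_inverse cremona_id cremona_inv cremona_comp.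
Proof.
elim/quotW=> f; rewrite (pi_cremona_inv f).
rewrite (pi_cremona_comp (birational_inv f) f); apply/cremona_piE.
by have /birational_pairP[_ _ _ gf] := valP f; exact: gf.
Qed.

Lemma cremona_compfV : right_inverse cremona_id cremona_inv cremona_comp.
Proof.
elim/quotW=> f; rewrite (pi_cremona_inv f).
rewrite (pi_cremona_comp f (birational_inv f)); apply/cremona_piE.
by have /birational_pairP[_ _ fg _] := valP f; exact: fg.
Qed.

HB.instance Definition _ := isGroup.Build cremona
  cremona_compA cremona_comp1f cremona_compf1 cremona_compVf cremona_compfV.

Definition represents (phi : cremona) (f : triple K) : bool :=
  same_map (val (repr phi)).1 f.

Definition is_subgroup (G : set cremona) : Prop :=
  G 1%g /\ forall phi psi, G phi -> G psi -> G (phi / psi)%g.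

Definition generated (S : set cremona) : set cremona := smallest is_subgroup S.

Definition linear_triple (A : 'M[K]_3) : triple K :=
  [tuple \sum_j A i j *: 'X_j | i < 3].

(* Aut(P^2) = PGL_3 *)
Definition Aut_plane : set cremona :=
  [set phi | exists2 A : 'M[K]_3, A \in unitmx & represents phi (linear_triple A)].

Definition linearizable (G : set cremona) : Prop :=
  exists h : cremona, [set (phi ^ h)%g | phi in G] `<=` Aut_plane.

End Cremona.

Section Points.
Variable K : fieldType.

(* A point of P^2 is given by a nonzero row vector v of homogeneous
   coordinates; v and w give the same point iff they span the same row space,
   (v == w)%MS.  A line is given in the same way by the coefficients of its
   equation. *)
Implicit Types (v w m l : 'rV[K]_3) (f : triple K).

Definition eval_at (p : {mpoly K[3]}) v : K := p.@[v ord0].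

Definition eval_triple f v : 'rV[K]_3 := \row_i eval_at (tnth f i) v.

(* P holds on a nonempty Zariski open subset of P^2 (or of its dual). *)
Definition generically (P : 'rV[K]_3 -> Prop) : Prop :=
  exists H : {mpoly K[3]}, [/\ H != 0, exists d : nat, H \is d.-homog &
    forall v, v != 0 -> eval_at H v != 0 -> P v].

(* phi is defined at v, with value w. *)
Definition maps_to (phi : cremona K) v w : Prop :=
  exists f, [/\ represents phi f, eval_triple f v != 0 &
                (eval_triple f v == w)%MS].

End Points.

Section Foliations.
Variable K : fieldType.

(* A foliation of P^2 is the kernel of a nonzero homogeneous 1-form
   a dx + b dy + c dz on K^3 that vanishes on the Euler field:
   x a + y b + z c = 0.  The coefficients may have a common factor: the form
   matters only up to multiplication by a rational function ([same_map]). *)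
Record foliation := Foliation {
  form :> triple K;
  form_homog_nz : homog_nz form;
  form_euler : \sum_(i < 3) 'X_i * tnth form i = 0 }.

(* The line l is the tangent line T_v F of the foliation at v, i.e. l is
   tangent to F at v.  That v lies on l follows from [form_euler]. *)
Definition tangent_at (F : foliation) (l v : 'rV[K]_3) : Prop :=
  [/\ v != 0, eval_triple F v != 0 & (eval_triple F v == l)%MS].

(* A generic line l is tangent to F at exactly d points. *)
Definition has_degree (F : foliation) (d : nat) : Prop :=
  generically (fun l : 'rV[K]_3 => exists p : 'I_d -> 'rV[K]_3,
    [/\ forall i, p i != 0, forall i j, (p i == p j)%MS -> i = j &
        forall v, v != 0 -> tangent_at F l v <-> exists i, (v == p i)%MS]).

(* For generic m, the tangent line to F at m is tangent to F at exactly one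
   second point m', and I maps m to m'. *)
Definition is_associated_involution (F : foliation) (I : cremona K) : Prop :=
  generically (fun m : 'rV[K]_3 => exists m' : 'rV[K]_3,
    [/\ maps_to I m m', ~~ (m == m')%MS &
        forall v, v != 0 -> tangent_at F (eval_triple F m) v <->
                            (v == m)%MS \/ (v == m')%MS]).

(* f^*(sum_i a_i dx_i) = sum_i (a_i o f) df_i *)
Definition pullback (f : triple K) (w : triple K) : triple K :=
  [tuple \sum_(i < 3) (tnth w i \mPo f) * (tnth f i)^`M(j) | j < 3].

Definition Iso (F : foliation) : set (cremona K) :=
  [set phi | Aut_plane phi /\
     exists f, represents phi f /\ same_map (pullback f F) F].

(* The vector field P d/dx + Q d/dy on the chart z = 1 defines F there, i.e.
   it is annihilated by the restriction of the form to this chart. *)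
Definition defined_in_chart_by (F : foliation) (P Q : {mpoly K[2]}) : Prop :=
  let chart := [tuple 'X_0; 'X_1; 1] : 3.-tuple {mpoly K[2]} in
  (P, Q) <> (0, 0) /\
  (tnth (form F) 0 \mPo chart) * P + (tnth (form F) 1 \mPo chart) * Q = 0.

Local Notation x := ('X_0 : {mpoly K[3]}).
Local Notation y := ('X_1 : {mpoly K[3]}).
Local Notation z := ('X_2 : {mpoly K[3]}).

(* The form i_R i_v (dx /\ dy /\ dz), divided by -z, for the
   homogenization v of the affine vector field of [jouanolou_in_chart] and
   the Euler field R. *)
Definition jouanolou_form : triple K :=
  [tuple z ^+ 3 - x ^+ 2 * y; x ^+ 3 - y ^+ 2 * z; y ^+ 3 - x * z ^+ 2].

Lemma jouanolou_homog_nz : homog_nz jouanolou_form.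
Proof.
apply/homog_nzP; split.
  exists ord0; apply/eqP; rewrite (tnth_nth 0) /=.
  move=> /(congr1 (meval (fun i : 'I_3 => (val i == 2%N)%:R))).
  rewrite rmorphB rmorphXn rmorphM rmorphXn rmorph0 /= !mevalXU /=.
  by rewrite expr0n mul0r subr0 expr1n => /eqP; rewrite oner_eq0.
have hX i : ('X_i : {mpoly K[3]}) \is 1.-homog by rewrite dhomogX; apply/eqP/mdeg1.
have hM (p q : {mpoly K[3]}) d e :
  p \is d.-homog -> q \is e.-homog -> p * q \is (d + e).-homog.
  exact: dhomogM.
have hE i k : ('X_i : {mpoly K[3]}) ^+ k \is k.-homog.
  by have := dhomogMn k (hX i); rewrite mul1n.
exists 3%N => -[[|[|[|i]]] ltin] //; rewrite (tnth_nth 0) /=; apply: rpredB.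
- exact: hE.
- exact: (hM _ _ 2%N 1%N).
- exact: hE.
- exact: (hM _ _ 2%N 1%N).
- exact: hE.
- exact: (hM _ _ 1%N 2%N).
Qed.

Lemma jouanolou_euler : \sum_(i < 3) 'X_i * tnth jouanolou_form i = 0.
Proof.
rewrite !big_ord_recl big_ord0 !(tnth_nth 0) /=.
have -> : lift ord0 (lift ord0 ord0) = 2 :> 'I_3 by apply: val_inj.
have -> : lift ord0 ord0 = 1 :> 'I_3 by apply: val_inj.
have -> : ord0 = 0 :> 'I_3 by apply: val_inj.
by ring.
Qed.

Definition jouanolou : foliation :=
  Foliation jouanolou_homog_nz jouanolou_euler.

Lemma jouanolou_in_chart :
  defined_in_chart_by jouanolou ('X_0 ^+ 3 - 'X_1 ^+ 2)
                                ('X_0 ^+ 2 * 'X_1 - 1).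
Proof.
split.
  move=> /(congr1 (fun PQ => meval (fun _ : 'I_2 => 0 : K) PQ.2)) /=.
  rewrite rmorphB rmorph1 rmorph0 rmorphM /= !mevalXU mulr0 sub0r.
  by move/eqP; rewrite oppr_eq0 oner_eq0.
rewrite !(tnth_nth 0) /= !rmorphB /= !rmorphXn !rmorphM /=.
by rewrite !comp_mpolyXU /=; ring.
Qed.

End Foliations.

Section Geiser.
Variable K : fieldType.
Implicit Types (q : 'I_7 -> 'rV[K]_3) (p v : 'rV[K]_3).

(* The lines and conics need not be irreducible; in particular the bound on
   lines makes the seven points distinct. *)
Definition general_position q : Prop :=
  [/\ forall i, q i != 0,
      forall L : {mpoly K[3]}, L != 0 -> L \is 1.-homog ->
        (#|[pred i | eval_at L (q i) == 0%R]| <= 2)%N &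
      forall C : {mpoly K[3]}, C != 0 -> C \is 2.-homog ->
        (#|[pred i | eval_at C (q i) == 0%R]| <= 5)%N].

Definition base_point_of_cubics q p v : Prop :=
  forall C : {mpoly K[3]}, C \is 3.-homog ->
    (forall i, eval_at C (q i) = 0) -> eval_at C p = 0 -> eval_at C v = 0.

Definition is_Geiser_involution q (phi : cremona K) : Prop :=
  general_position q /\
  generically (fun p => exists p',
    [/\ maps_to phi p p', ~~ (p == p')%MS,
        forall i, ~~ (q i == p)%MS /\ ~~ (q i == p')%MS &
        forall v, v != 0 -> base_point_of_cubics q p v <->
          (exists i, (v == q i)%MS) \/ (v == p)%MS \/ (v == p')%MS]).

Definition Geiser_type (phi : cremona K) : Prop :=
  exists (h : cremona K) q, is_Geiser_involution q (phi ^ h)%g.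

End Geiser.

(* Main.v *)
Require Import Defs.
From mathcomp Require Import all_boot all_order all_algebra.
From mathcomp Require Import boolp classical_sets cardinality reals.
From mathcomp Require Import complex mpoly ring zify.

(** Put m = (x, y, z) and Q(m) = (y^2, z^2, x^2).  The Jouanolou form is the
    cross product Q(m) x m, so the tangent line at m is spanned by m and Q(m),
    and a point v of a line l is a tangency point of l iff l . Q(v) = 0.

    Degree.  Thus the tangency points of l are its intersection with a conic;
    the discriminant of this intersection is, up to a square, the Klein quartic
    of l, hence two points for generic l ([jouanolou_degree]).

    Involution.  On the tangent line at m, with v = s m + t Q(m), the tangency
    equation det(Q(v), Q(m), m) = 0 becomes t (2 s D + t E) = 0, where
    D = det(m, Q(m), B), E = det(m, Q(m), Q(Q(m))) and B is the polarization of
    Q at (m, Q(m)).  The root t = 0 is m itself, and the other one is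
    I(m) = E m - 2 D Q(m) ([second_tangency]).  Cramer identities give
    I(I(m)) = T^3 m for a form T ([invol_invol]).  An associated involution is
    prescribed on a dense open set, so it is unique ([associated_uniq]).

    Isotropy.  A linear map A preserves the foliation iff A^-1 Q(A m) is a
    quadratic syzygy of the three coefficients of the form.  Such syzygies are
    the vectors l(m) m + g Q(m), and l = 0 because A^-1 Q(A m) is divergence
    free while l(m) m has divergence 4 l(m).  Hence Q(A m) = g A Q(m): the
    squares of the rows of A contain no mixed terms, A is monomial, and one gets
    the 21 maps x_i |-> a^(4^i) x_(i+j) with a^7 = 1 ([isotropy_mono],
    [IsoP]).  They commute with I and I is not linear, so the group has order 42
    ([card_generated]).

    Geiser type.  The seven singular points are (1, t^3, t) with t^7 = 1.  The
    cubics through them are the combinations of the coefficients of the form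
    ([cubics_through_sing]); therefore the base points of the pencil defined by
    p are the singular points and the points tangent to the same line as p, and
    I is literally a Geiser involution.  General position holds because a line
    or a conic restricted to the curve (1, t^3, t) has no term of degree one
    below the top, while the sum of three, or of six, distinct seventh roots of
    unity is not zero ([general_position_sing]).

    Linearization.  The group is the product of Z/2 and the Frobenius group of
    order 21, and this product does not embed in PGL_3
    ([no_Z2_times_F21_in_PGL3]): an involution of the plane fixes exactly one
    isolated point, which would be fixed by the Frobenius group; but an element
    of order 7 that is conjugate to its square and normalized to have
    eigenvalue 1 at that point is the identity
    ([square_conjugate_unipotent]). *)

Set Implicit Arguments.
Unset Strict Implicit.
Unset Printing Implicit Defensive.

Import GRing.Theory Num.Theory.

Local Open Scope ring_scope.
Local Open Scope quotient_scope.

(** * The tangency involution as a vector identity *)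

Lemma ord3_ind (P : 'I_3 -> Prop) : P 0 -> P 1 -> P 2 -> forall i, P i.
Proof.
by move=> P0 P1 P2 [[|[|[|//]]] lti]; [move: P0 | move: P1 | move: P2];
  congr P; apply: val_inj.
Qed.

Lemma ord3D : ((0 + 1 = 1 :> 'I_3) * (1 + 1 = 2 :> 'I_3) * (2 + 1 = 0 :> 'I_3))
 * ((0 + 2 = 2 :> 'I_3) * (1 + 2 = 0 :> 'I_3) * (2 + 2 = 1 :> 'I_3)).
Proof. by do ![split]; apply: val_inj. Qed.

Section Vectors.
Variable R : comNzRingType.
Implicit Types (u v w m : 'I_3 -> R) (i j : 'I_3).

Lemma sum3 (V : nmodType) (F : 'I_3 -> V) : \sum_i F i = F 0 + F 1 + F 2.
Proof.
rewrite !big_ord_recl big_ord0 addr0 addrA.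
by congr (F _ + F _ + F _); apply: val_inj.
Qed.

(** The divergence-free homogeneous vector field (y^2, z^2, x^2), which together
    with the radial field spans the foliation.  Indices are added in Z/3, so
    that the cyclic symmetry of the coordinates is built in. *)
Definition quad u i := u (i + 1) ^+ 2.
Definition polar u w i := u (i + 1) * w (i + 1).
Definition cross u w i := u (i + 1) * w (i + 2) - u (i + 2) * w (i + 1).
Definition det3 u v w := \sum_i u i * cross v w i.

(** [polar_det u] and [iter_det u] are the coefficients D and E of the tangency
    equation 2 s D + t E = 0 on the tangent line at u. *)
Definition polar_det u := det3 u (quad u) (polar u (quad u)).
Definition iter_det u := det3 u (quad u) (quad (quad u)).
Definition invol u i := iter_det u * u i - 2 * polar_det u * quad u i.

(** The factor T by which the form is multiplied under the involution; its cube
    is the common factor of the square of the involution. *)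
Definition multiplier u :=
  let v := quad u in let b := polar u v in let w := quad v in
  iter_det u ^+ 3 - 4 * polar_det u * iter_det u * det3 u b w
  + 8 * polar_det u ^+ 2 * det3 v b w.

Lemma det3E u v w : det3 u v w = u 0 * (v 1 * w 2 - v 2 * w 1)
  + u 1 * (v 2 * w 0 - v 0 * w 2) + u 2 * (v 0 * w 1 - v 1 * w 0).
Proof. by rewrite /det3 sum3 /cross !ord3D. Qed.

Lemma cramer3 a b c d i : det3 b c d * a i - det3 a c d * b i
  + det3 a b d * c i - det3 a b c * d i = 0.
Proof. by rewrite !det3E; elim/ord3_ind: i; ring. Qed.

Lemma quadD u v w a b : (forall i, u i = a * v i + b * w i) ->
  forall i, quad u i = a ^+ 2 * quad v i + 2 * a * b * polar v w i
                       + b ^+ 2 * quad w i.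
Proof. by move=> uE i; rewrite /quad /polar uE; ring. Qed.

Lemma polarD u u' v w a b a' b' : (forall i, u i = a * v i + b * w i) ->
  (forall i, u' i = a' * v i + b' * w i) ->
  forall i, polar u u' i = a * a' * quad v i + (a * b' + a' * b) * polar v w i
                       + b * b' * quad w i.
Proof. by move=> uE uE' i; rewrite /quad /polar uE uE'; ring. Qed.

Section Involution.
Variable m : 'I_3 -> R.
Let v := quad m.
Let b := polar m v.
Let w := quad v.
Let d := polar_det m.
Let e := iter_det m.
Let p := det3 m b w.
Let q := det3 v b w.
Let s := e ^+ 2 - 4 * d * p.
Let r := 4 * d * q.
Let u := invol m.

Let multiplierE : multiplier m = e * s + 2 * d * r.
Proof. by rewrite /multiplier -/d -/e -/v -/b -/w -/p -/q /s /r; ring. Qed.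

Let uE i : u i = e * m i + (- 2 * d) * v i.
Proof. by rewrite /u /invol -/d -/e -/v; ring. Qed.

(** The point [invol m] is tangent to the line spanned by m and [quad m], that
    is, its image by [quad] stays in this span: the Cramer relation between m,
    [quad m], the polarization and the iterate eliminates the last two. *)
Lemma quad_invol i : quad u i = r * m i + s * v i.
Proof.
rewrite (quadD uE) -/v -/b -/w.
have := cramer3 m v b w i; rewrite -/p -/q -/(polar_det m) -/(iter_det m) -/d
  -/e.
move=> h; apply/eqP; rewrite -subr_eq0; apply/eqP.
transitivity (- (4 * d) * (q * m i - p * v i + e * b i - d * w i)).
  by rewrite /s /r; ring.
by rewrite h mulr0.
Qed.

Lemma cross_invol i : cross (quad u) u i = multiplier m * cross (quad m) m i.
Proof.
rewrite /cross !quad_invol !uE multiplierE -/v; ring.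
Qed.

Let quad2 i : quad (quad u) i = r ^+ 2 * v i + 2 * r * s * b i + s ^+ 2 * w i.
Proof. by rewrite (quadD quad_invol). Qed.

Let polar2 i : polar u (quad u) i
  = e * r * v i + (e * s + r * (- 2 * d)) * b i + (- 2 * d) * s * w i.
Proof. by rewrite (polarD uE quad_invol). Qed.

Let det_comb f g x y z : (forall i, f i = r * m i + s * v i) ->
  (forall i, g i = x * v i + y * b i + z * w i) ->
  det3 u f g = multiplier m * (y * d + z * e).
Proof.
move=> fE gE; rewrite multiplierE (det3E u) !fE !gE !uE.
have -> : y * d + z * e = y * det3 m v b + z * det3 m v w by [].
by move: e d r s => e' d' r' s'; rewrite !det3E; ring.
Qed.

(** The tangent line at [invol m] is the tangent line at m, so its second
    tangency point is m again. *)
Lemma invol_invol i : invol u i = multiplier m ^+ 3 * m i.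
Proof.
rewrite {1}/invol {1}/polar_det {1}/iter_det (det_comb quad_invol quad2).
rewrite (det_comb quad_invol polar2) quad_invol uE multiplierE; ring.
Qed.

End Involution.
End Vectors.

Section Morph.
Variables (R S : comNzRingType) (g : {rmorphism R -> S}).
Implicit Types (u v w : 'I_3 -> R) (x y z : 'I_3 -> S).

Lemma quad_morph u x : (forall i, g (u i) = x i) ->
  forall i, g (quad u i) = quad x i.
Proof. by move=> uE i; rewrite /quad rmorphXn /= uE. Qed.

Lemma polar_morph u w x z : (forall i, g (u i) = x i) ->
  (forall i, g (w i) = z i) -> forall i, g (polar u w i) = polar x z i.
Proof. by move=> uE wE i; rewrite /polar rmorphM /= uE wE. Qed.

Lemma cross_morph u w x z : (forall i, g (u i) = x i) ->
  (forall i, g (w i) = z i) -> forall i, g (cross u w i) = cross x z i.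
Proof. by move=> uE wE i; rewrite /cross rmorphB /= !rmorphM /= !uE !wE. Qed.

Lemma det3_morph u v w x y z : (forall i, g (u i) = x i) ->
  (forall i, g (v i) = y i) -> (forall i, g (w i) = z i) ->
  g (det3 u v w) = det3 x y z.
Proof.
move=> uE vE wE; rewrite /det3 rmorph_sum; apply: eq_bigr => i _.
by rewrite rmorphM /= uE (cross_morph vE wE).
Qed.

Variables (u : 'I_3 -> R) (x : 'I_3 -> S) (uE : forall i, g (u i) = x i).
Let quE := quad_morph uE.
Let poE := polar_morph uE quE.
Let qqE := quad_morph quE.

Lemma polar_det_morph : g (polar_det u) = polar_det x.
Proof. exact: det3_morph. Qed.

Lemma iter_det_morph : g (iter_det u) = iter_det x.
Proof. exact: det3_morph. Qed.

Lemma multiplier_morph : g (multiplier u) = multiplier x.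
Proof.
rewrite /multiplier rmorphD rmorphB /= !(rmorphM, rmorphXn) /= !rmorph_nat.
rewrite polar_det_morph iter_det_morph (det3_morph uE poE qqE).
by rewrite (det3_morph quE poE qqE).
Qed.

Lemma invol_morph i : g (invol u i) = invol x i.
Proof.
rewrite /invol rmorphB /= 3!rmorphM /= rmorph_nat polar_det_morph
  iter_det_morph.
by rewrite uE quE.
Qed.

End Morph.

(** * Triples of forms and their values *)

Section Polynomials.
Variable K : fieldType.
Local Notation mpoly := {mpoly K[3]}.
Implicit Types (u v w : 'I_3 -> mpoly) (f g : triple K).

Definition coords (i : 'I_3) : mpoly := 'X_i.

Lemma coords_homog i : coords i \is 1.-homog.
Proof. by rewrite dhomogX; apply/eqP/mdeg1. Qed.

Lemma quad_homog d u : (forall i, u i \is d.-homog) ->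
  forall i, quad u i \is (d * 2).-homog.
Proof. by move=> hu i; apply: dhomogMn. Qed.

Lemma polar_homog d e u w : (forall i, u i \is d.-homog) ->
  (forall i, w i \is e.-homog) -> forall i, polar u w i \is (d + e).-homog.
Proof. by move=> hu hw i; apply: dhomogM. Qed.

Lemma cross_homog d e u w : (forall i, u i \is d.-homog) ->
  (forall i, w i \is e.-homog) -> forall i, cross u w i \is (d + e).-homog.
Proof. by move=> hu hw i; apply: rpredB; apply: dhomogM. Qed.

Lemma det3_homog d e k u v w : (forall i, u i \is d.-homog) ->
  (forall i, v i \is e.-homog) -> (forall i, w i \is k.-homog) ->
  det3 u v w \is (d + (e + k)).-homog.
Proof.
by move=> hu hv hw; apply: rpred_sum => i _; apply: dhomogM (hu i) _;
  apply: cross_homog.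
Qed.

Lemma natr_homog n d (p : mpoly) : p \is d.-homog -> n%:R * p \is d.-homog.
Proof. by move=> hp; rewrite mulr_natl; apply: rpredMn. Qed.

Let hX := coords_homog.
Let hq := quad_homog hX.
Let hb := polar_homog hX hq.
Let hw := quad_homog hq.

Lemma polar_det_homog : polar_det coords \is 6.-homog.
Proof. exact: (det3_homog hX hq hb). Qed.

Lemma iter_det_homog : iter_det coords \is 7.-homog.
Proof. exact: (det3_homog hX hq hw). Qed.

Lemma multiplier_homog : multiplier coords \is 21.-homog.
Proof.
rewrite /multiplier; apply: rpredD; first apply: rpredB.
- exact: (dhomogMn 3 iter_det_homog).
- have := natr_homog 4 (dhomogM polar_det_homog (dhomogM iter_det_homog
    (det3_homog hX hb hw))).
  by rewrite !mulrA.
- have := natr_homog 8 (dhomogM (dhomogMn 2 polar_det_homog) (det3_homog hq hb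
  hw)).
  by rewrite mulrA.
Qed.

Lemma invol_homog i : invol coords i \is 8.-homog.
Proof.
apply: rpredB; first exact: (dhomogM iter_det_homog (hX i)).
by have := natr_homog 2 (dhomogM polar_det_homog (hq i)); rewrite mulrA.
Qed.

Definition invol_triple : triple K := [tuple invol coords i | i < 3].

Lemma invol_tripleE i : tnth invol_triple i = invol coords i.
Proof. exact: tnth_mktuple. Qed.

Lemma jouanolouE i : tnth (jouanolou_form K) i = cross (quad coords) coords i.
Proof.
by elim/ord3_ind: i; rewrite (tnth_nth 0) /cross /quad /coords !ord3D /=; ring.
Qed.

Section Eval.
Variable v : 'rV[K]_3.

Lemma coords_eval i : (coords i).@[v ord0] = v ord0 i.
Proof. exact: mevalXU. Qed.

Lemma eval_polar_det : eval_at (polar_det coords) v = polar_det (v ord0).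
Proof. exact: (polar_det_morph (g := meval (v ord0)) coords_eval). Qed.

Lemma eval_multiplier : eval_at (multiplier coords) v = multiplier (v ord0).
Proof. exact: (multiplier_morph (g := meval (v ord0)) coords_eval). Qed.

Lemma eval_tripleE f i : eval_triple f v ord0 i = eval_at (tnth f i) v.
Proof. by rewrite mxE. Qed.

Lemma eval_invol i : eval_triple invol_triple v ord0 i = invol (v ord0) i.
Proof.
rewrite eval_tripleE invol_tripleE.
exact: (invol_morph (g := meval (v ord0)) coords_eval).
Qed.

Lemma eval_jouanolou i :
  eval_triple (jouanolou K) v ord0 i = cross (quad (v ord0)) (v ord0) i.
Proof.
rewrite eval_tripleE jouanolouE.
apply: (cross_morph (g := meval (v ord0))); last exact: coords_eval.
exact: quad_morph coords_eval.
Qed.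

End Eval.

Lemma comp_coords f i : coords i \mPo f = tnth f i.
Proof. exact: comp_mpolyXt. Qed.

Lemma comp_invol f i : invol coords i \mPo f = invol (tnth f) i.
Proof. exact: (invol_morph (g := comp_mpoly f) (comp_coords f)). Qed.

Lemma eqmx_rowP (v w : 'rV[K]_3) : v != 0 -> w != 0 ->
  reflect (forall i j, v ord0 i * w ord0 j = v ord0 j * w ord0 i) (v == w)%MS.
Proof.
move=> v0 w0; apply: (iffP idP) => [/andP[/sub_rVP[a ->] _] i j|h].
  by rewrite !mxE; ring.
have [i vi] : exists i, v ord0 i != 0 by apply/rV0Pn.
have [j wj] : exists i, w ord0 i != 0 by apply/rV0Pn.
apply/andP; split; apply/sub_rVP.
  exists (v ord0 j / w ord0 j); apply/rowP => k.
  by rewrite !mxE -mulrAC -(h k j) mulfK.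
exists (w ord0 i / v ord0 i); apply/rowP => k.
by rewrite !mxE mulrAC [X in X / _]mulrC (h k i) [X in X / _]mulrC mulfK.
Qed.

End Polynomials.

Lemma nat_poly_eq0 (C : numFieldType) (p : {poly C}) :
  (forall n : nat, p.[n%:R] = 0) -> p = 0.
Proof.
move=> p0; apply: (@roots_geq_poly_eq0 _ p [seq n%:R | n <- iota 0 (size p)]).
- by apply/allP => _ /mapP[n _ ->]; apply/eqP.
- by rewrite map_inj_uniq ?iota_uniq // => i j /eqP; rewrite eqr_nat => /eqP.
- by rewrite size_map size_iota.
Qed.

(** Kronecker substitution: for N larger than the degree, x_i = t^(N^i) sends
    distinct monomials to distinct powers of t. *)
Lemma mpoly_eval0 (C : numFieldType) (p : {mpoly C[3]}) :
  (forall v, eval_at p v = 0) -> p = 0.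
Proof.
move=> p0; apply/eqP/negPn/negP => pn0.
pose N := msize p; pose wt (m :
  'X_{1..3}) := (m 0%R + N * (m 1%R + N * m 2%R))%N.
pose q : {poly C} := \sum_(m <- msupp p) p@_m *: 'X^(wt m).
have lt_supp m i : m \in msupp p -> (m i < N)%N.
  move=> /msize_mdeg_lt; apply: leq_ltn_trans.
  by rewrite mdegE (bigD1 i) //= leq_addr.
have wt_inj : {in msupp p &, injective wt}.
  have digit a b x y : (a < N)%N -> (b < N)%N ->
      (a + N * x = b + N * y)%N -> a = b /\ x = y.
    move=> ltaN ltbN e.
    have eab : a = b.
      by have := congr1 (modn^~ N) e;
        rewrite ![(_ + N * _)%N]addnC !(mulnC N) !modnMDl !modn_small.
    split=> //; move/eqP: e; rewrite eab eqn_add2l eqn_pmul2l;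
      first by move/eqP.
    exact: leq_ltn_trans ltaN.
  move=> m n mp np /digit[||e0 /digit[||e1 e2]]; try exact: lt_supp.
  by apply/mnmP; elim/ord3_ind.
have q0 : q = 0.
  apply: nat_poly_eq0 => n.
  pose v : 'rV[C]_3 := \row_i n%:R ^+ (N ^ i).
  rewrite -(p0 v) /eval_at mevalE horner_sum; apply: eq_bigr => m _.
  rewrite hornerZ hornerXn; congr (_ * _).
  rewrite !big_ord_recl big_ord0 mulr1 !mxE -!exprM -!exprD; congr (_ ^+ _).
  have -> : lift ord0 (lift ord0 ord0) = 2 :> 'I_3 by apply: val_inj.
  have -> : lift ord0 ord0 = 1 :> 'I_3 by apply: val_inj.
  have -> : ord0 = 0 :> 'I_3 by apply: val_inj.
  by rewrite /wt /= expn0 expn1 mul1n mulnDr mulnA mulnn.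
have lm := mlead_supp pn0.
have : q`_(wt (mlead p)) = mleadc p.
  rewrite coef_sum (bigD1_seq (mlead p)) ?msupp_uniq //=.
  rewrite coefZ coefXn eqxx mulr1 big_seq_cond big1 ?addr0 // => m.
  case/andP=> mp nm; rewrite coefZ coefXn.
  case: eqP => [/wt_inj e|]; last by rewrite mulr0.
  by rewrite e ?eqxx // in nm.
by rewrite q0 coef0 => /esym/eqP; rewrite mleadc_eq0 (negPf pn0).
Qed.

(** * Triples representing a Cremona transformation *)

Section Representatives.
Variable K : fieldType.
Implicit Types (f g : triple K) (phi psi : cremona K) (F G : birational K).

Lemma represents_pi F f :
  represents (\pi_(cremona K) F) f = same_map (val F).1 f.
Proof.
have e := repr_piE F; rewrite /represents; move: (repr _) e => G e.
have [dG _ _ _] := birational_pairP _ _ (valP G).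
have [dF _ _ _] := birational_pairP _ _ (valP F).
rewrite /same_map dG.1 dF.1 /=; case: homog_nz => //=.
rewrite /birational_eq proportional_sym in e.
apply/idP/idP; first exact: proportional_trans dG.1 _.
by rewrite proportional_sym in e; apply: proportional_trans dF.1 _.
Qed.

Lemma represents_homog phi f : represents phi f -> homog_nz f.
Proof. by case/and3P. Qed.

Lemma represents_prop phi f g :
  represents phi f -> represents phi g -> proportional f g.
Proof.
case/and3P=> h hf fp /and3P[_ hg gp]; apply: proportional_trans h _ gp.
by rewrite proportional_sym.
Qed.

Lemma represents_repr phi : represents phi (val (repr phi)).1.
Proof.
have [d _ _ _] := birational_pairP _ _ (valP (repr phi)).
by rewrite /represents /same_map d.1 proportional_refl.
Qed.

Lemma represents_dominant phi f : represents phi f -> dominant f.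
Proof.
case/and3P=> _ hf fp; split=> // p d hp p0.
have [[/homog_nzP[[k nzk] _] dom] _ _ _] := birational_pairP _ _ (valP (repr
  phi)).
have nzk' := prop_nz hf fp nzk.
apply: (dom p d hp); have := comp_mpoly_prop k hp fp.
by rewrite p0 mulr0 => /eqP; rewrite mulf_eq0 expf_eq0 (negPf nzk') andbF =>
  /eqP.
Qed.

Lemma represents_inj phi psi f g : represents phi f -> represents psi g ->
  proportional f g -> phi = psi.
Proof.
rewrite -(reprK phi) -(reprK psi) => hf hg fg; apply/cremona_piE.
have [hf' hg'] := (represents_homog hf, represents_homog hg).
have rf := represents_repr phi; have rg := represents_repr psi.
rewrite reprK in hf; rewrite reprK in hg.
apply: proportional_trans hf' (represents_prop rf hf) _.
exact: proportional_trans hg' fg (represents_prop hg rg).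
Qed.

Lemma represents_mul phi psi f g : represents phi f -> represents psi g ->
  represents (phi * psi)%g (comp_triple f g).
Proof.
move=> hf hg.
have [df dg] := (represents_dominant hf, represents_dominant hg).
have rf := represents_repr phi; have rg := represents_repr psi.
have drf := represents_dominant rf; have drg := represents_dominant rg.
have -> : (phi * psi)%g =
    \pi_(cremona K) (birational_comp (repr phi) (repr psi)) by [].
rewrite represents_pi /=; apply/and3P; split.
- exact: (dominant_comp drf drg).1.
- exact: (dominant_comp df dg).1.
- apply: proportional_trans (dominant_comp drf dg).1 _ _.
    by apply: prop_compr drf.1 drg.1 dg.1 _; apply: represents_prop rg hg.
  exact: prop_compl (represents_prop rf hf).
Qed.

Lemma represents_id : represents (1%g : cremona K) (id_triple K).
Proof.
have -> : (1%g : cremona K) = \pi_(cremona K) (birational_id K) by [].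
by rewrite represents_pi /= /same_map homog_nz_id proportional_refl.
Qed.

(** The factors [c] and [e] absorb the excess degree of the composites. *)
Lemma birational_pairI f g c e : homog_nz f -> homog_nz g ->
  c != 0 -> e != 0 ->
  (forall i, tnth f i \mPo g = c * 'X_i) ->
  (forall i, tnth g i \mPo f = e * 'X_i) -> birational_pair f g.
Proof.
suff half f' g' c' : homog_nz f' -> homog_nz g' -> c' != 0 ->
    (forall i, tnth f' i \mPo g' = c' * 'X_i) ->
    same_map (comp_triple f' g') (id_triple K).
  move=> hf hg c0 e0 fg gf; apply/and4P; split=> //; first exact: half fg.
  exact: half gf.
case/homog_nzP=> _ [d hf] /homog_nzP[_ [d' hg]] c0 fg.
apply/and3P; split; last 2 first.
- exact: homog_nz_id.
- by apply/proportionalP => i j; rewrite !comp_tripleE !fg !id_tripleE; ring.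
apply/homog_nzP; split.
  exists 0; rewrite comp_tripleE fg mulf_neq0 //.
  by rewrite -msize_poly_eq0 msizeX.
by exists (d * d')%N => i; rewrite comp_tripleE; apply: comp_mpoly_homog.
Qed.

End Representatives.

(** * The second tangency point of a tangent line *)

Section Tangency.
Variable K : numFieldType.
Implicit Types (u v m : 'I_3 -> K).

Lemma polar_det_cross m : polar_det m != 0 -> exists i, cross (quad m) m i != 0.
Proof.
move=> t0; apply/existsP; apply: contraNT t0 => /existsPn c0; apply/eqP.
have -> : polar_det m = - det3 (polar m (quad m)) (quad m) m.
  by rewrite /polar_det !det3E; ring.
rewrite /det3 big1 ?oppr0 // => i _.
by have := c0 i; rewrite negbK => /eqP ->; rewrite mulr0.
Qed.

(** A vector v with det(v, Q(m), m) = 0 is a combination s m + t Q(m), because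
    D is not zero; the second equation then factors as t (2 s D + t E) = 0. *)
Lemma second_tangency m v : polar_det m != 0 ->
  det3 v (quad m) m = 0 -> det3 (quad v) (quad m) m = 0 ->
  exists c, (forall i, v i = c * m i) \/ (forall i, v i = c * invol m i).
Proof.
move=> d0 v_on q_on; set d := polar_det m in d0; set e := iter_det m.
set b := polar m (quad m); set w := quad (quad m).
pose s := det3 v (quad m) b; pose t := det3 m v b.
have vE i : d * v i = s * m i + t * quad m i.
  have := cramer3 v m (quad m) b i; rewrite -[det3 m _ b]/d -/b.
  have -> : det3 v m (quad m) = - det3 v (quad m) m by rewrite !det3E; ring.
  rewrite v_on -/s oppr0 mul0r subr0 => h; apply/eqP; rewrite -subr_eq0 -h.
  apply/eqP; have -> : det3 v m b = - t by rewrite /t !det3E; ring.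
  by ring.
have qE i : d ^+ 2 * quad v i
    = s ^+ 2 * quad m i + 2 * s * t * b i + t ^+ 2 * w i.
  by rewrite -(quadD vE) /quad exprMn.
have : t * (2 * s * d + t * e) = 0.
  have det_comb (x q : 'I_3 -> K) :
      (forall i, x i = s ^+ 2 * q i + 2 * s * t * b i + t ^+ 2 * w i) ->
      t * (2 * s * det3 m q b + t * det3 m q w) = - det3 x q m.
    by move=> xE; rewrite (det3E x) !xE !det3E; ring.
  rewrite (det_comb _ _ qE).
  have -> : det3 (fun i => d ^+ 2 * quad v i) (quad m) m
      = d ^+ 2 * det3 (quad v) (quad m) m by rewrite !det3E; ring.
  by rewrite q_on mulr0 oppr0.
move/eqP; rewrite mulf_eq0 => /orP[/eqP t0|/eqP se].
  exists (s / d); left=> i; apply: (mulfI d0); rewrite vE t0 mul0r addr0.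
  by rewrite mulrA [d * _]mulrC divfK.
have d20 : 2 * d ^+ 2 != 0 by rewrite mulf_neq0 ?expf_neq0 // pnatr_eq0.
exists (- t / (2 * d ^+ 2)); right=> i; apply: (mulfI d20).
rewrite [RHS]mulrA [X in _ = X * _]mulrC divfK // /invol -/d -/e.
have -> : 2 * d ^+ 2 * v i = 2 * d * (d * v i) by ring.
rewrite vE; have -> : 2 * d * (s * m i + t * quad m i)
  = (2 * s * d + t * e) * m i - t * (e * m i - 2 * d * quad m i) by ring.
by rewrite se; ring.
Qed.

End Tangency.

Section Associated.
Variable K : numFieldType.
Local Notation J := (jouanolou K).
Implicit Types (v m l : 'rV[K]_3).

Lemma row3_neq0 v : (v != 0) = [exists i, v ord0 i != 0].
Proof. by apply/rV0Pn/existsP. Qed.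

Lemma eqmx_scale v m c : v != 0 -> (forall i, v ord0 i = c * m ord0 i) ->
  (v == m)%MS.
Proof.
move=> v0 vE; have m0 : m != 0.
  apply: contraNneq v0 => m0; apply/eqP/rowP => i.
  by rewrite vE m0 !mxE mulr0.
by apply/eqmx_rowP => // i j; rewrite !vE; ring.
Qed.

Lemma tangent_at_det l v : tangent_at J l v ->
  \sum_i v ord0 i * l ord0 i = 0 /\ \sum_i quad (v ord0) i * l ord0 i = 0.
Proof.
case=> v0 w0 /andP[_ /sub_rVP[c ->]].
split; under eq_bigr do rewrite mxE mulrCA eval_jouanolou;
  by rewrite -mulr_sumr -/(det3 _ _ _) det3E; ring.
Qed.

(** The non-vanishing of [polar_det] separates the two tangency points, and that
    of [multiplier] makes the second one a regular point of the foliation. *)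
Lemma tangency_generic m : polar_det (m ord0) != 0 ->
  multiplier (m ord0) != 0 ->
  let m' := eval_triple (invol_triple K) m in
  [/\ m' != 0, ~~ (m == m')%MS & forall v, v != 0 ->
      tangent_at J (eval_triple J m) v <-> (v == m)%MS \/ (v == m')%MS].
Proof.
move=> t0 s0 m'; have m'E i : m' ord0 i = invol (m ord0) i by apply: eval_invol.
have w0 : eval_triple J m != 0.
  rewrite row3_neq0; have [i wi] := polar_det_cross t0;
    by apply/existsP; exists i; rewrite eval_jouanolou.
have m0 : m != 0.
  apply: contraNneq t0 => ->; rewrite /polar_det det3E !mxE; apply/eqP; ring.
have w'E i : eval_triple J m' ord0 i
    = multiplier (m ord0) * eval_triple J m ord0 i.
  rewrite !eval_jouanolou -cross_invol /cross /quad.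
  by rewrite !m'E.
have w'0 : eval_triple J m' != 0.
  move: w0; rewrite !row3_neq0 => /existsP[i wi]; apply/existsP; exists i.
  by rewrite w'E mulf_neq0.
have m'0 : m' != 0.
  apply: contraNneq w'0 => ->; apply/eqP/rowP => i.
  by rewrite eval_jouanolou /cross /quad !mxE; ring.
split=> //.
  apply/negP => /eqmx_rowP - /(_ m0 m'0) par.
  have [k] := polar_det_cross t0; case/negP; apply/eqP.
  have d0 : - (2 * polar_det (m ord0)) != 0 by rewrite oppr_eq0 mulf_neq0
    ?pnatr_eq0.
  apply: (mulfI d0); rewrite mulr0; have := par (k + 2) (k + 1).
  rewrite !m'E /invol => /eqP; rewrite -subr_eq0 => /eqP <-.
  by rewrite /cross; ring.
move=> v v0; split.
  move=> tv; have [] := tangent_at_det tv.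
  under eq_bigr do rewrite eval_jouanolou.
  under [X in _ -> X = 0 -> _]eq_bigr do rewrite eval_jouanolou.
  rewrite -!/(det3 _ _ _) => h1 h2.
  have [c [h|h]] := second_tangency t0 h1 h2; [left|right].
    exact: eqmx_scale h.
  by apply: (@eqmx_scale _ _ c) => // i; rewrite m'E.
have tgt_of u : u != 0 -> eval_triple J u != 0 ->
  (eval_triple J u == eval_triple J m)%MS ->
   (v == u)%MS -> tangent_at J (eval_triple J m) v.
  move=> u0 wu0 um /andP[/sub_rVP[c vE] _].
  have c0 : c != 0 by apply: contraNneq v0 => c0; rewrite vE c0 scale0r.
  have wE i : eval_triple J v ord0 i = c ^+ 3 * eval_triple J u ord0 i.
    by rewrite vE !eval_jouanolou /cross /quad !mxE; ring.
  have wv0 : eval_triple J v != 0.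
    move: wu0; rewrite !row3_neq0 => /existsP[i wi]; apply/existsP; exists i.
    by rewrite wE mulf_neq0 ?expf_neq0.
  split=> //; apply/eqmxP/(eqmx_trans _ (eqmxP um)); apply/eqmxP.
  exact: eqmx_scale wE.
case; apply: tgt_of => //; first by rewrite submx_refl.
exact: eqmx_scale w'E.
Qed.

End Associated.

Section Involution.
Variable K : numFieldType.
Implicit Types (v m : 'rV[K]_3) (I : cremona K).

Definition pt011 : 'rV[K]_3 := \row_i (i != 0)%:R.

(** One numerical point shows that none of the polynomials that define the
    generic locus is identically zero. *)
Lemma invol011 : [/\ polar_det (pt011 ord0) = -1,
  multiplier (pt011 ord0) = - 8%:R,
  invol (pt011 ord0) 0 = 2, invol (pt011 ord0) 1 = 0 &
  invol (pt011 ord0) 2 = - 2].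
Proof.
by split; rewrite /invol /multiplier /polar_det /iter_det !det3E /polar /quad
  !ord3D !mxE /=;
  ring.
Qed.

Lemma polar_det_neq0 : polar_det (@coords K) != 0.
Proof.
apply/eqP => t0; have := eval_polar_det pt011; have [-> _ _ _ _] := invol011.
rewrite t0 /eval_at meval0 => /esym/eqP; by rewrite oppr_eq0 oner_eq0.
Qed.

Lemma multiplier_neq0 : multiplier (@coords K) != 0.
Proof.
apply/eqP => t0; have := eval_multiplier pt011; have [_ -> _ _ _] := invol011.
by rewrite t0 /eval_at meval0 => /esym/eqP; rewrite oppr_eq0 pnatr_eq0.
Qed.

Lemma homog_nz_invol : homog_nz (invol_triple K).
Proof.
apply/homog_nzP; split; last by exists 8 => i;
  rewrite invol_tripleE invol_homog.
exists 0; apply/eqP => t0; have := eval_invol pt011 0.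
have [_ _ -> _ _] := invol011.
by rewrite eval_tripleE t0 /eval_at meval0 => /esym/eqP; rewrite pnatr_eq0.
Qed.

Lemma invol_birational_pair : birational_pair (invol_triple K) (invol_triple K).
Proof.
have d0 := expf_neq0 3 multiplier_neq0.
have cI i : tnth (invol_triple K) i \mPo invol_triple K
    = multiplier (@coords K) ^+ 3 * 'X_i.
  rewrite invol_tripleE comp_invol (funext (invol_tripleE K)).
  exact: invol_invol.
exact: (birational_pairI homog_nz_invol homog_nz_invol d0 d0 cI cI).
Qed.

Definition invol_cremona : cremona K := \pi_(cremona K)
  (exist _ (invol_triple K, invol_triple K) invol_birational_pair :
    birational K).

Lemma represents_invol : represents invol_cremona (invol_triple K).
Proof.
by rewrite represents_pi /same_map /= homog_nz_invol proportional_refl.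
Qed.

Lemma invol_associated : is_associated_involution (jouanolou K) invol_cremona.
Proof.
exists (polar_det (@coords K) * multiplier (@coords K)); split.
- by rewrite mulf_neq0 ?polar_det_neq0 ?multiplier_neq0.
- by exists (6 + 21)%N; apply: dhomogM (polar_det_homog K) (multiplier_homog K).
move=> m m0; rewrite /eval_at mevalM -!/(eval_at _ m) eval_polar_det
  eval_multiplier.
rewrite mulf_eq0 negb_or => /andP[t0 s0].
have [m'0 mm' tgt] := tangency_generic t0 s0.
exists (eval_triple (invol_triple K) m); split=> //.
by exists (invol_triple K); split; rewrite ?represents_invol ?submx_refl.
Qed.

Lemma generically_and (P Q : 'rV[K]_3 -> Prop) : generically P ->
  generically Q ->
  generically (fun v => P v /\ Q v).
Proof.
case=> H [H0 [d hH] HP] [H' [H'0 [d' hH'] HQ]]; exists (H * H'); split.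
- by rewrite mulf_neq0.
- by exists (d + d')%N; apply: dhomogM.
move=> v v0; rewrite /eval_at mevalM mulf_eq0 negb_or => /andP[? ?].
by split; [apply: HP | apply: HQ].
Qed.

(** The factor x_0 takes care of the zero vector, which is no point of the
    plane. *)
Lemma mpoly_generically0 (p : {mpoly K[3]}) :
  generically (fun v => eval_at p v = 0) -> p = 0.
Proof.
case=> H [H0 _ Hp]; have : p * H * 'X_0 = 0.
  apply: mpoly_eval0 => v; rewrite /eval_at !mevalM.
  have [->|v0] := eqVneq v 0; first by rewrite mevalXU mxE mulr0.
  rewrite -!/(eval_at _ v).
  have [->|Hv] := eqVneq (eval_at H v) 0; first by rewrite mulr0 mul0r.
  by rewrite Hp // !mul0r.
move/eqP; rewrite !mulf_eq0 (negPf H0) orbF => /orP[/eqP//|].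
by rewrite -msize_poly_eq0 msizeX.
Qed.

Lemma maps_to_represents I f m m' : represents I f -> maps_to I m m' ->
  exists c, eval_triple f m = c *: m'.
Proof.
move=> rf [g [rg g0 /andP[gm' m'g]]]; apply/sub_rVP/(submx_trans _ gm').
have /proportionalP fg := represents_prop rf rg.
have [->|f0] := eqVneq (eval_triple f m) 0; first exact: sub0mx.
suff /andP[] : (eval_triple f m == eval_triple g m)%MS by [].
apply/eqmx_rowP => // i j; rewrite !eval_tripleE /eval_at -!mevalM;
  congr (_.@[_]).
exact: fg.
Qed.

(** The tangency condition determines the image of a generic point, and two
    triples that are proportional at generic points are proportional. *)
Lemma associated_uniq (F : foliation K) I I' :
  is_associated_involution F I -> is_associated_involution F I' -> I = I'.
Proof.
move=> hI hI'; have rI := represents_repr I; have rI' := represents_repr I'.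
apply: (represents_inj rI rI'); apply/proportionalP => i j.
move: (val _).1 (val _).1 rI rI' => f f' rI rI'.
apply/eqP; rewrite -subr_eq0; apply/eqP/mpoly_generically0.
have [H [H0 hH HP]] := generically_and hI hI'; exists H; split=> // m m0 Hm.
have [[m1 [mapI mm1 t1]] [m2 [mapI' mm2 t2]]] := HP m m0 Hm.
have m2m1 : (m2 == m1)%MS.
  have [_ [_ _ m20]] : True /\ tangent_at F (eval_triple F m) m.
    by split=> //; apply/t1 => //; left; rewrite submx_refl.
  case: mapI' => g' [_ g'0 /eqmxP g'm2].
  have m2n0 : m2 != 0 by rewrite -mxrank_eq0 -g'm2 mxrank_eq0.
  have := (t1 m2 m2n0).1; case=> //; last first.
    by move/andP=> [a b]; rewrite b a in mm2.
  by apply/t2 => //; right; rewrite submx_refl.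
have [c fE] := maps_to_represents rI mapI.
have [c' f'E] := maps_to_represents rI' mapI'.
have /sub_rVP[e m2E] : (m2 <= m1)%MS by case/andP: m2m1.
rewrite /eval_at mevalB !mevalM -!/(eval_at _ m) -!eval_tripleE fE f'E m2E !mxE.
by ring.
Qed.

End Involution.

(** * Linear maps and pullback of foliations *)

Section LinearMaps.
Variable K : fieldType.
Implicit Types (A B : 'M[K]_3) (f g w : triple K) (phi : cremona K).

Lemma linear_tripleE A i : tnth (linear_triple A) i = \sum_j A i j *: 'X_j.
Proof. exact: tnth_mktuple. Qed.

Lemma linear_triple_homog A i : tnth (linear_triple A) i \is 1.-homog.
Proof.
by rewrite linear_tripleE rpred_sum // => j _; apply: rpredZ;
  apply: coords_homog.
Qed.

Lemma proportional_scale a A :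
  proportional (linear_triple (a *: A)) (linear_triple A).
Proof.
have sE i : tnth (linear_triple (a *: A)) i = a *: tnth (linear_triple A) i.
  rewrite !linear_tripleE scaler_sumr; apply: eq_bigr => j _.
  by rewrite mxE scalerA.
by apply/proportionalP => i j; rewrite !sE -!scalerAl mulrC.
Qed.

Lemma linear_triple1 : linear_triple 1%:M = id_triple K.
Proof.
apply: eq_from_tnth => i; rewrite linear_tripleE id_tripleE (bigD1 i) //=.
rewrite mxE eqxx scale1r big1 ?addr0 // => j ji.
by rewrite mxE eq_sym (negPf ji) scale0r.
Qed.

Lemma linear_triple_comp A B :
  comp_triple (linear_triple A) (linear_triple B) = linear_triple (A *m B).
Proof.
apply: eq_from_tnth => i; rewrite comp_tripleE !linear_tripleE raddf_sum /=.
transitivity (\sum_j \sum_k (A i j * B j k) *: ('X_k : {mpoly K[3]})).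
  apply: eq_bigr => j _; rewrite comp_mpolyZ comp_mpolyXt linear_tripleE.
  by rewrite scaler_sumr; apply: eq_bigr => k _; rewrite scalerA.
by rewrite exchange_big; apply: eq_bigr => k _; rewrite mxE scaler_suml.
Qed.

Lemma linear_triple_eval A (v : 'rV[K]_3) i :
  eval_triple (linear_triple A) v ord0 i = \sum_j A i j * v ord0 j.
Proof.
rewrite eval_tripleE linear_tripleE /eval_at raddf_sum; apply: eq_bigr => j _.
by rewrite /= mevalZ mevalXU.
Qed.

Lemma linear_triple_homog_nz A : A \in unitmx -> homog_nz (linear_triple A).
Proof.
move=> uA; apply/homog_nzP; split; last first.
  by exists 1%N; apply: linear_triple_homog.
apply/existsP; apply: contraLR uA => /existsPn l0; have -> : A = 0; last first.
  by rewrite unitmxE det0 unitr0.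
apply/matrixP => i j; have := l0 i; rewrite negbK => /eqP li.
have := linear_triple_eval A (delta_mx 0 j) i.
rewrite eval_tripleE li /eval_at meval0 (bigD1 j) //= mxE !eqxx mulr1.
rewrite big1 ?addr0 => [<-|k kj]; first by rewrite mxE.
by rewrite mxE (negPf kj) andbF mulr0.
Qed.

Lemma linear_birational_pair A : A \in unitmx ->
  birational_pair (linear_triple A) (linear_triple (invmx A)).
Proof.
move=> uA; have uV : invmx A \in unitmx by rewrite unitmx_inv.
apply: (@birational_pairI _ _ _ 1 1);
  rewrite ?linear_triple_homog_nz ?oner_neq0 //.
- move=> i; rewrite -comp_tripleE linear_triple_comp mulmxV // linear_triple1.
  by rewrite id_tripleE mul1r.
- move=> i; rewrite -comp_tripleE linear_triple_comp mulVmx // linear_triple1.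
  by rewrite id_tripleE mul1r.
Qed.

Definition linear_cremona A (uA : A \in unitmx) : cremona K := \pi_(cremona K)
  (exist _ (linear_triple A, linear_triple (invmx A)) (linear_birational_pair
    uA)
    : birational K).

Lemma represents_linear A (uA : A \in unitmx) :
  represents (linear_cremona uA) (linear_triple A).
Proof.
by rewrite represents_pi /same_map /= linear_triple_homog_nz //
  proportional_refl.
Qed.

(** After composing with the inverse of [B], every vector is an eigenvector of
    the matrix, which is then scalar. *)
Lemma proportional_linear A B : B \in unitmx ->
  proportional (linear_triple A) (linear_triple B) -> exists c, A = c *: B.
Proof.
move=> uB /(prop_compl (linear_triple (invmx B))).
rewrite !linear_triple_comp mulmxV // linear_triple1 => /proportionalP.
set M := A *m invmx B; have : A = M *m B by rewrite mulmxKV.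
move: M => M -> par {A}.
have parv (v : 'rV[K]_3) i j : (\sum_k M i k * v ord0 k) * v ord0 j
    = (\sum_k M j k * v ord0 k) * v ord0 i.
  have := congr1 (fun p => eval_at p v) (par i j); rewrite /eval_at !mevalM.
  by rewrite !id_tripleE !mevalXU -!/(eval_at _ v) -!eval_tripleE
    !linear_triple_eval.
have off i j : i != j -> M i j = 0.
  move=> ij; have := parv (delta_mx 0 j) i j.
  rewrite !mxE !eqxx (negPf ij) mulr0 mulr1 => <-.
  rewrite (bigD1 j) //= mxE !eqxx mulr1 big1 ?addr0 // => k kj.
  by rewrite mxE (negPf kj) mulr0.
have diag i j : M i i = M j j.
  have := parv (const_mx 1) i j; rewrite !mxE !mulr1.
  rewrite (bigD1 i) //= [in RHS](bigD1 j) //= !mxE !mulr1.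
  by rewrite !big1 ?addr0 // => k kj; rewrite mxE off ?mul0r // eq_sym.
exists (M 0 0); rewrite -mul_scalar_mx; congr (_ *m _).
apply/matrixP => i j; rewrite mxE; case: eqVneq => [<-|/off ->//].
by rewrite mulr1n.
Qed.

End LinearMaps.

Section Pullback.
Variable K : fieldType.
Implicit Types (A B : 'M[K]_3) (f g w : triple K).

Lemma pullbackE f w j :
  tnth (pullback f w) j = \sum_i (tnth w i \mPo f) * (tnth f i)^`M(j).
Proof. exact: tnth_mktuple. Qed.

(** The derivatives of the factor [p] contribute a multiple of the Euler
    contraction of the form, which vanishes. *)
Lemma pullback_scale f g w p d : (forall i, tnth w i \is d.-homog) ->
  \sum_i 'X_i * tnth w i = 0 -> (forall i, tnth f i = p * tnth g i) ->
  forall j, tnth (pullback f w) j = p ^+ d.+1 * tnth (pullback g w) j.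
Proof.
move=> hw euler fE j; rewrite !pullbackE.
have euler_g : \sum_i tnth g i * (tnth w i \mPo g) = 0.
  have := congr1 (comp_mpoly g) euler; rewrite raddf_sum raddf0 /= => e0.
  rewrite -[RHS]e0.
  by apply: eq_bigr => i _; rewrite rmorphM /= comp_mpolyXt.
under eq_bigr => i _.
  rewrite (comp_mpoly_scale (hw i) fE) fE mderivM.
  have -> : p ^+ d * (tnth w i \mPo g)
       * (p^`M(j) * tnth g i + p * (tnth g i)^`M(j))
    = p ^+ d * p^`M(j) * (tnth g i * (tnth w i \mPo g))
      + p ^+ d.+1 * ((tnth w i \mPo g) * (tnth g i)^`M(j)).
    by rewrite exprS; ring.
  over.
by rewrite big_split /= -!mulr_sumr euler_g mulr0 add0r.
Qed.

(** Isotropy may thus be tested on any triple that represents the map. *)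
Lemma pullback_proportional f g w d : (forall i, tnth w i \is d.-homog) ->
  \sum_i 'X_i * tnth w i = 0 -> homog_nz f -> homog_nz g ->
  proportional f g -> exists p q, [/\ p != 0, q != 0 &
    forall i, p * tnth (pullback f w) i = q * tnth (pullback g w) i].
Proof.
move=> hw euler /homog_nzP[[k fk] _] hg fg.
have gk := prop_nz hg fg fk; move/proportionalP: fg => fg.
(* [h] is a polynomial multiple of [f] and, by proportionality, of [g] *)
pose h : triple K := [tuple tnth g k * tnth f i | i < 3].
exists (tnth g k ^+ d.+1), (tnth f k ^+ d.+1); split;
  rewrite ?expf_neq0 // => i.
rewrite -(@pullback_scale h f w _ d hw euler (fun i => tnth_mktuple _ i)).
by apply: pullback_scale => // j; rewrite tnth_mktuple mulrC fg.
Qed.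

Lemma pullback_linear A w k : tnth (pullback (linear_triple A) w) k
  = \sum_i A i k *: (tnth w i \mPo linear_triple A).
Proof.
rewrite pullbackE; apply: eq_bigr => i _; rewrite linear_tripleE.
rewrite raddf_sum (bigD1 k) //= mderivZ mderivX mnm1E eqxx.
rewrite big1 ?addr0 => [|l lk]; last first.
  by rewrite mderivZ mderivX mnm1E (negPf lk) scale0r scaler0.
have -> : (U_(k) - U_(k) = 0 :> 'X_{1..3})%MM by apply/mnmP => l;
  rewrite mnmBE subnn mnm0E.
by rewrite mpolyX0 scale1r -mul_mpolyC mulr1 mulrC mul_mpolyC.
Qed.

End Pullback.

(** * Quadratic syzygies of the Jouanolou form *)

Section Syzygy.
Variable K : numFieldType.

Lemma quintic_zero (c0 c1 c2 c3 c4 c5 : K) :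
  (forall x, c0 + c1 * x + c2 * x ^+ 2 + c3 * x ^+ 3 + c4 * x ^+ 4
             + c5 * x ^+ 5 = 0) ->
  [/\ c0 = 0, c1 = 0, c2 = 0, c3 = 0 & c4 = 0 /\ c5 = 0].
Proof.
move=> h; pose p := Poly [:: c0; c1; c2; c3; c4; c5].
have p0 : p = 0.
  apply: nat_poly_eq0 => n; rewrite horner_Poly /= -[RHS](h n%:R); ring.
have cE i : [:: c0; c1; c2; c3; c4;
  c5]`_i = 0 by rewrite -coef_Poly -/p p0 coef0.
by split; [exact: (cE 0) | exact: (cE 1%N) | exact: (cE 2%N) | exact: (cE 3%N) |
  split; [exact: (cE 4%N) | exact: (cE 5%N)]].
Qed.

Lemma sum3_shift (F : 'I_3 -> K) t : \sum_i F i = F t + F (t + 1) + F (t + 2).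
Proof. by rewrite sum3; elim/ord3_ind: t; rewrite !ord3D; ring. Qed.

Lemma shift3 (t : 'I_3) : ((t + 1 + 1 = t + 2) * (t + 1 + 2 = t)
  * (t + 2 + 1 = t) * (t + 2 + 2 = t + 1)).
Proof. by elim/ord3_ind: t; do ![split]; apply: val_inj. Qed.

Lemma shift3_neq (t : 'I_3) : ((t + 1 == t = false) * (t + 2 == t = false)
  * (t + 2 == t + 1 = false)).
Proof. by elim/ord3_ind: t. Qed.

Lemma ord3_shift_ind (t : 'I_3) (P : 'I_3 -> Prop) :
  P t -> P (t + 1) -> P (t + 2) -> forall i, P i.
Proof.
move=> P0 P1 P2 i; rewrite -(subrK t i) addrC.
by elim/ord3_ind: (i - t); rewrite ?addr0.
Qed.

Definition qform (c : 'I_3 -> 'I_3 -> K) (m : 'I_3 -> K) :=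
  \sum_r \sum_s c r s * (m r * m s).

(** Restricting a syzygy to a coordinate line gives a quintic in one variable;
    its coefficients express those of the syzygy by one another. *)
Lemma syzygy_edge (c : 'I_3 -> 'I_3 -> 'I_3 -> K) (t : 'I_3) :
  (forall k r s, c k r s = c k s r) ->
  (forall m, \sum_k qform (c k) m * cross (quad m) m k = 0) ->
  [/\ c (t + 1) t t = 0 /\ c (t + 2) t t = c t (t + 1) (t + 1),
      2 * c (t + 1) t (t + 1) = c t t t,
      c (t + 1) (t + 1) (t + 1) = 2 * c t t (t + 1),
      c (t + 2) t (t + 1) = 0 & c (t + 2) (t + 1) (t + 1) = 0].
Proof.
move=> csym syz.
have edge x : c (t + 2) (t + 1) (t + 1)
  + 2 * c (t + 2) t (t + 1) * x
  + (c (t + 2) t t - c t (t + 1) (t + 1)) * x ^+ 2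
  + (c (t + 1) (t + 1) (t + 1) - 2 * c t t (t + 1)) * x ^+ 3
  + (2 * c (t + 1) t (t + 1) - c t t t) * x ^+ 4
  + c (t + 1) t t * x ^+ 5 = 0.
  (* the point of a coordinate line, with coordinates x, 1, 0 from t on *)
  pose m i := if i == t then x else if i == t + 1 then 1 else 0 : K.
  have [m0 m1 m2] : [/\ m t = x, m (t + 1) = 1 & m (t + 2) = 0].
    by rewrite /m eqxx !shift3_neq eqxx.
  have := syz m; rewrite (sum3_shift _ t) /cross /quad /qform.
  rewrite !(sum3_shift _ t) !shift3 m0 m1 m2 => <-.
  rewrite !(csym _ (t + 1) t) !(csym _ (t + 2) t) !(csym _ (t + 2) (t + 1)).
  by ring.
have [e0 e1 e2 e3 [e4 e5]] := quintic_zero edge.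
have two (x : K) : 2 * x = 0 -> x = 0.
  by move/eqP; rewrite mulf_eq0 pnatr_eq0 => /eqP.
by split=> //; first split=> //; try (apply/eqP; rewrite -subr_eq0; apply/eqP);
  rewrite ?subr0 //; apply: two.
Qed.

(** The three coordinate lines show that a syzygy is l(m) m + g Q(m); the trace
    of its partial derivatives is 4 l. *)
Lemma syzygy_traceless (c : 'I_3 -> 'I_3 -> 'I_3 -> K) :
  (forall k r s, c k r s = c k s r) ->
  (forall m, \sum_k qform (c k) m * cross (quad m) m k = 0) ->
  (forall r, \sum_k c k k r = 0) ->
  forall k r s, c k r s = if (r == k + 1) && (s == k + 1) then c 0 1 1 else 0.
Proof.
move=> csym syz tr.
have edge t := syzygy_edge t csym syz.
have two (x : K) : 2 * x = 0 -> x = 0.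
  by move/eqP; rewrite mulf_eq0 pnatr_eq0 => /eqP.
have d0 t : c t t t = 0.
  have [_ e1 _ _ _] := edge t; have [_ _ e2 _ _] := edge (t + 2).
  rewrite !shift3 in e2; apply: (two _ (two _ _)).
  have := congr1 (fun x => 2 * x) (tr t); rewrite (sum3_shift _ t) mulr0 => <-.
  by rewrite !mulrDr (csym _ _ t) e1 -e2; ring.
have g t : c t (t + 1) (t + 1) = c 0 1 1.
  have [[_ e0] _ _ _ _] := edge 0.
  have [[_ e1] _ _ _ _] := edge 1; rewrite !ord3D in e0 e1.
  by elim/ord3_ind: t; rewrite !ord3D //; congruence.
move=> k r s.
have [_ _ y2 _ _] := edge k.
have [_ _ _ y3 _] := edge (k + 1).
have [[y4 _] y1 _ _ _] := edge (k + 2).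
rewrite !shift3 !d0 in y1 y2 y3 y4; move/esym/two: y2 => y2; move/two: y1 => y1.
have kk1 : (k == k + 1) = false by rewrite eq_sym shift3_neq.
by elim/(@ord3_shift_ind k): r; elim/(@ord3_shift_ind k): s;
  rewrite ?eqxx ?kk1 ?shift3_neq ?andbF ?d0 ?g //=; rewrite csym.
Qed.

End Syzygy.

(** * The isotropy group *)

Section Monomial.
Variable K : numFieldType.
Local Notation J := (jouanolou K).
Implicit Types (A B : 'M[K]_3) (phi : cremona K) (a b : K) (i j k l : 'I_3).

(** The exponents 1, 4, 16 are chosen so that the square of each coefficient is
    the previous one when a^7 = 1. *)
Definition monomial_mx a j : 'M[K]_3 := \matrix_(i,
  k) (a ^+ (4 ^ i) *+ (k == i + j)).

Lemma linear_monoE a j i :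
  tnth (linear_triple (monomial_mx a j)) i = a ^+ (4 ^ i) *: 'X_(i + j).
Proof.
rewrite linear_tripleE (bigD1 (i + j)) //= mxE eqxx big1 ?addr0 // => k kij.
by rewrite mxE (negPf kij) scale0r.
Qed.

Lemma exp4D a i j : a ^+ 7 = 1 -> a ^+ (4 ^ (i + j)%R) = a ^+ (4 ^ i * 4 ^ j).
Proof.
move=> a7; have e : (4 ^ (i + j)%R = 4 ^ i * 4 ^ j %[mod 7])%N.
  by elim/ord3_ind: i; elim/ord3_ind: j.
by rewrite -(expr_mod _ a7) e expr_mod.
Qed.

Lemma mono_mul a b j l : b ^+ 7 = 1 ->
  monomial_mx a j *m monomial_mx b l = monomial_mx (a * b ^+ (4 ^ j)) (j + l).
Proof.
move=> b7; apply/matrixP => i k; rewrite !mxE (bigD1 (i + j)) //= !mxE eqxx.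
rewrite big1 ?addr0 => [|t tij]; last by rewrite mxE (negPf tij) mul0r.
by rewrite mulr1n mulrnAr addrA exprMn -exprM (mulnC (4 ^ j)%N) -exp4D.
Qed.

Lemma mono1 : monomial_mx 1 0 = 1%:M.
Proof.
by apply/matrixP => i k; rewrite !mxE expr1n addr0 eq_sym.
Qed.

Definition mono_inv a j := a^-1 ^+ (4 ^ (- j)%R).

Lemma mono_inv7 a j : a ^+ 7 = 1 -> mono_inv a j ^+ 7 = 1.
Proof. by move=> a7; rewrite /mono_inv -exprM mulnC exprM exprVn a7 invr1
  expr1n. Qed.

Lemma mono_mulV a j : a ^+ 7 = 1 ->
  monomial_mx a j *m monomial_mx (mono_inv a j) (- j) = 1%:M.
Proof.
move=> a7; have aV7 : a^-1 ^+ 7 = 1 by rewrite exprVn a7 invr1.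
have a0 : a != 0 by apply: contra_eq_neq a7 => ->;
  rewrite expr0n eq_sym oner_eq0.
rewrite mono_mul ?mono_inv7 // /mono_inv -exprM -(exp4D (- j) j aV7) addNr.
by rewrite expr1 subrr mulfV // mono1.
Qed.

Lemma mono_unit a j : a ^+ 7 = 1 -> monomial_mx a j \in unitmx.
Proof. by move=> a7; have [] := mulmx1_unit (mono_mulV j a7). Qed.

Lemma mono_inj a b j l : a ^+ 7 = 1 -> b ^+ 7 = 1 ->
  proportional (linear_triple (monomial_mx a j)) (linear_triple (monomial_mx b
    l)) ->
  a = b /\ j = l.
Proof.
move=> a7 b7 /(proportional_linear (mono_unit l b7))[c /matrixP e].
have a0 : a != 0 by apply: contra_eq_neq a7 => ->;
  rewrite expr0n eq_sym oner_eq0.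
have jl : j = l.
  have := e 0 j; rewrite !mxE !add0r eqxx; case: eqVneq => // _.
  by rewrite mulr0 expr1 => /eqP; rewrite (negPf a0).
split=> //; have e0 : a = c * b by have := e 0 j; rewrite -jl !mxE !add0r eqxx.
have e1 : a ^+ 4 = c * b ^+ 4 by have := e 1 (1 + j); rewrite -jl !mxE eqxx.
have c7 : c ^+ 7 = 1.
  by have := congr1 (fun x => x ^+ 7) e0; rewrite exprMn a7 b7 mulr1.
have c3 : c ^+ 3 = 1.
  apply: (mulIf (expf_neq0 4 a0)); rewrite mul1r {1}e1 e0.
  by rewrite mulrA -exprSr exprMn.
suff c1 : c = 1 by rewrite e0 c1 mul1r.
by rewrite -c7 -[7%N]/(3 + 3 + 1)%N !exprD c3 !mul1r expr1.
Qed.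

Lemma comp_jouanolou (f : triple K) i :
  tnth (jouanolou_form K) i \mPo f = cross (quad (tnth f)) (tnth f) i.
Proof.
rewrite jouanolouE.
apply: (cross_morph (g := comp_mpoly f)); last exact: comp_coords.
exact: quad_morph (comp_coords f).
Qed.

(** The exponents 1, 4, 16 add up to 21, so even the form is preserved. *)
Lemma pullback_mono a j : a ^+ 7 = 1 ->
  pullback (linear_triple (monomial_mx a j)) (jouanolou_form K) =
    jouanolou_form K.
Proof.
move=> a7; apply: eq_from_tnth => k; rewrite pullback_linear.
have qE i : quad (tnth (linear_triple (monomial_mx a j))) i
    = a ^+ (4 ^ i) *: quad (@coords K) (i + j).
  rewrite /quad linear_monoE exprZn addrAC exp4D // -exprM; congr (_ *: _).
  have -> : (4 ^ i * 4 ^ 1%R * 2 = 7 * 4 ^ i + 4 ^ i)%N by rewrite expn1; lia.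
  by rewrite exprD exprM a7 expr1n mul1r.
rewrite (bigD1 (k - j)) //= big1 ?addr0 => [|i ikj]; last first.
  rewrite mxE; case: eqVneq => [kE|_]; last by rewrite scale0r.
  by rewrite kE addrK eqxx in ikj.
rewrite mxE subrK eqxx comp_jouanolou jouanolouE /cross !qE !linear_monoE.
rewrite ![k - j + _ + j]addrAC subrK -!scalerAl -!scalerAr !scalerA scalerBr
  !scalerA.
have e3 : a ^+ (4 ^ (k - j)%R) * (a ^+ (4 ^ (k - j + 1)%R) * a ^+ (4 ^ (k - j +
  2)%R)) = 1.
  rewrite -!exprD; have -> : (4 ^ (k - j)%R + (4 ^ (k - j + 1)%R + 4 ^ (k - j +
    2)%R) = 7 * 3)%N.
    by elim/ord3_ind: (k - j).
  by rewrite exprM a7 expr1n.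
rewrite mulr1n e3 (mulrC (a ^+ (4 ^ (k - j + 2)%R))) e3 !scale1r.
by [].
Qed.

End Monomial.

Section Isotropy.
Variable K : numFieldType.
Local Notation J := (jouanolou K).
Implicit Types (A B : 'M[K]_3) (phi : cremona K) (a b : K) (i j k l : 'I_3).

(** The hypothesis says that Q(A m) = g A Q(m).  Two nonzero entries in a row
    would give a mixed term; the remaining entries satisfy a_(i+1)^2 = g a_i, so
    that a = a_0 / g satisfies a^8 = a. *)
Lemma squares_mono A g : A \in unitmx ->
  (forall i r s, A (i + 1) (r + 1) * A (i + 1) (s + 1) = (g * A i r) *+ (r ==
    s)) ->
  exists a j, a ^+ 7 = 1 /\ A = g *: monomial_mx a j.
Proof.
move=> uA sq.
have [j Aj] : exists j, A 0 j != 0.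
  apply/existsP; apply: contraLR uA => /existsPn A0.
  rewrite unitmxE (expand_det_row _ 0) big1 ?unitr0 // => j _.
  by have := A0 j; rewrite negbK => /eqP ->; rewrite mul0r.
have sq1 i : A (i + 1) (i + 1 + j) ^+ 2 = g * A i (i + j).
  by rewrite expr2 [i + 1 + j]addrAC sq eqxx.
have nz i : A i (i + j) != 0.
  have step k : A (k + 1) (k + 1 + j) != 0 -> A k (k + j) != 0.
    by move=> kn; have := expf_neq0 2 kn;
      rewrite sq1 mulf_eq0 negb_or => /andP[].
  have n2 : A 2 (2 + j) != 0 by apply: step; rewrite ord3D add0r.
  have n1 : A 1 (1 + j) != 0 by apply: step; rewrite ord3D.
  by elim/ord3_ind: i => //; rewrite add0r.
have g0 : g != 0.
  have := expf_neq0 2 (nz (0 + 1)); rewrite sq1 mulf_eq0 negb_or => /andP[] //.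
have off i k : k != i + j -> A i k = 0.
  move=> kij; apply: (mulIf (nz i)); rewrite mul0r -{1 2}(subrK 1 i).
  rewrite -(subrK 1 k) -{1}(subrK 1 (i + j)) sq.
  rewrite (inj_eq (subIr 1)) (negPf kij) //.
pose a := A 0 j / g.
(* going down the cycle 0, 2, 1, 0 *)
have A0 : A 0 j = g * a by rewrite mulrC divfK.
have A2 : A 2 (2 + j) = g * a ^+ 2.
  have := sq1 2; rewrite !ord3D add0r A0 exprMn expr2 -mulrA => /(mulfI g0) <-.
  by [].
have A1 : A 1 (1 + j) = g * a ^+ 4.
  have := sq1 1; rewrite !ord3D A2 exprMn expr2 -mulrA -exprM => /(mulfI g0) <-.
  by [].
have a0 : a != 0 by rewrite mulf_neq0 ?invr_eq0.
have a7 : a ^+ 7 = 1.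
  apply: (mulIf a0); rewrite mul1r -exprSr; apply: (mulfI (expf_neq0 2 g0)).
  have := sq1 0; rewrite !ord3D A1 add0r A0 exprMn -exprM => ->.
  by rewrite mulrA -expr2.
exists a, j; split=> //; apply/matrixP => i k; rewrite !mxE.
case: eqVneq => [->|/off ->]; last by rewrite mulr0.
rewrite mulr1n; elim/ord3_ind: i.
- by rewrite add0r A0 expr1.
- by rewrite A1.
- rewrite A2 -[(4 ^ _)%N]/(7 * 2 + 2)%N exprD exprM a7 expr1n mul1r; ring.
Qed.

(** The pullback evaluated on A^-1 Q(A m) is the form at A m evaluated on
    Q(A m), which is zero; a form proportional to it vanishes there too. *)
Lemma pullback_syzygy A : A \in unitmx ->
  (exists i, tnth (pullback (linear_triple A) J) i != 0) ->
  proportional (pullback (linear_triple A) J) J ->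
  let N := invmx A in
  let c k r s := \sum_i N k i * (A (i + 1) r * A (i + 1) s) in
  forall m, \sum_k qform (c k) m * cross (quad m) m k = 0.
Proof.
move=> uA [h nz] /proportionalP par N c m.
pose L := linear_triple A.
pose w k : {mpoly K[3]} := \sum_i N k i *: quad (tnth L) i.
have Aw i : \sum_k A i k *: w k = quad (tnth L) i.
  transitivity (\sum_k \sum_l (A i k * N k l) *: quad (tnth L) l).
    apply: eq_bigr => k _; rewrite scaler_sumr; apply: eq_bigr => l _.
    by rewrite scalerA.
  rewrite exchange_big /=.
  have e l : \sum_k (A i k * N k l) *: quad (tnth L) l
      = (i == l)%:R *: quad (tnth L) l.
    have := mulmxV uA => /matrixP/(_ i l); rewrite !mxE => <-.
    by rewrite scaler_suml.
  rewrite (eq_bigr _ (fun l _ => e l)) (bigD1 i) //= eqxx scale1r big1 ?addr0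
    // => l li.
  by rewrite eq_sym (negPf li) scale0r.
have wpb : \sum_k w k * tnth (pullback L (jouanolou_form K)) k = 0.
  transitivity (det3 (quad (tnth L)) (quad (tnth L)) (tnth L)); last first.
    by rewrite det3E; ring.
  rewrite /det3; under [RHS]eq_bigr =>
    i _ do rewrite -Aw -comp_jouanolou mulr_suml.
  rewrite exchange_big; apply: eq_bigr => k _;
    rewrite pullback_linear mulr_sumr.
  by apply: eq_bigr => i _; rewrite -scalerAl -scalerAr.
have wJ : \sum_k w k * tnth (jouanolou_form K) k = 0.
  apply: (mulfI nz); rewrite mulr0.
  have := congr1 ( *%R (tnth (jouanolou_form K) h)) wpb; rewrite mulr0;
    apply: etrans.
  rewrite !mulr_sumr; apply: eq_bigr => k _.
  rewrite mulrCA [RHS]mulrCA; congr (_ * _).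
  by rewrite par mulrC.
pose v : 'rV[K]_3 := \row_i m i.
have := congr1 (fun p => eval_at p v) wJ; rewrite /eval_at meval0 raddf_sum;
  apply: etrans.
apply: eq_bigr => k _; rewrite /= mevalM -!/(eval_at _ v) -eval_tripleE.
rewrite eval_jouanolou; congr (_ * _); last by rewrite /cross /quad !mxE.
rewrite /w /eval_at raddf_sum /qform.
under [LHS]eq_bigr do under eq_bigr do rewrite mulr_suml.
under [LHS]eq_bigr do rewrite exchange_big.
rewrite exchange_big; apply: eq_bigr => i _ /=.
rewrite mevalZ /quad mevalM -!/(eval_at _ v) -!eval_tripleE linear_triple_eval.
under [X in _ = _ * (X * _)]eq_bigr do rewrite mxE.
under [X in _ = _ * (_ * X)]eq_bigr do rewrite mxE.
rewrite big_distrlr /= mulr_sumr; apply: eq_bigr => r _.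
rewrite mulr_sumr; apply: eq_bigr => s _; ring.
Qed.

(** The trace of the partial derivatives of A^-1 Q(A m) is a combination of the
    entries (i + 1, i) of A A^-1, hence zero. *)
Lemma isotropy_mono A : A \in unitmx ->
  (exists i, tnth (pullback (linear_triple A) J) i != 0) ->
  proportional (pullback (linear_triple A) J) J ->
  exists g a j, a ^+ 7 = 1 /\ A = g *: monomial_mx a j.
Proof.
move=> uA nz par; pose N := invmx A.
pose c k r s := \sum_i N k i * (A (i + 1) r * A (i + 1) s).
have syz m : \sum_k qform (c k) m * cross (quad m) m k = 0.
  exact: (pullback_syzygy uA nz par).
have AN i l : \sum_k A i k * N k l = (i == l)%:R.
  by have := mulmxV uA => /matrixP/(_ i l); rewrite !mxE.
have Ac i r s : \sum_k A i k * c k r s = A (i + 1) r * A (i + 1) s.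
  rewrite /c; under eq_bigr do rewrite mulr_sumr.
  rewrite exchange_big /=.
  have e l : \sum_k A i k * (N k l * (A (l + 1) r * A (l + 1) s))
      = (i == l)%:R * (A (l + 1) r * A (l + 1) s).
    by rewrite -AN mulr_suml; apply: eq_bigr => k _; rewrite !mulrA.
  rewrite (eq_bigr _ (fun l _ => e l)) (bigD1 i) //= eqxx mul1r big1 ?addr0 //
    => l li.
  by rewrite eq_sym (negPf li) mul0r.
have csym k r s : c k r s = c k s r.
  by apply: eq_bigr => i _; rewrite [A _ r * _]mulrC.
have tr r : \sum_k c k k r = 0.
  rewrite exchange_big big1 // => i _.
  transitivity ((\sum_k A (i + 1) k * N k i) * A (i + 1) r).
    by rewrite mulr_suml; apply: eq_bigr => k _; ring.
  by rewrite AN shift3_neq mul0r.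
have cE := syzygy_traceless csym syz tr.
have [] := @squares_mono A (c 0 1 1) uA; last by move=> a [j aj];
  exists (c 0 1 1), a, j.
move=> i r s; rewrite -Ac (bigD1 r) //= cE big1 ?addr0 => [|k kr]; last first.
  by rewrite cE (inj_eq (addIr 1)) eq_sym (negPf kr) mulr0.
by rewrite eqxx (inj_eq (addIr 1)) eq_sym; case: eqP => _;
  rewrite ?mulr0 // mulrC.
Qed.

Lemma jouanolou_homog i : tnth (jouanolou_form K) i \is 3.-homog.
Proof.
by rewrite jouanolouE; apply: (@cross_homog _ 2 1);
  [apply: (@quad_homog _ 1) |]; apply: coords_homog.
Qed.

Lemma IsoP phi : Iso J phi <->
  exists a j, a ^+ 7 = 1 /\ represents phi (linear_triple (monomial_mx a j)).
Proof.
split=> [[[A uA rA] [f [rf sf]]]|[a [j [a7 r]]]]; last first.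
  split; first by exists (monomial_mx a j); rewrite ?mono_unit.
  exists (linear_triple (monomial_mx a j)); split; first exact: r.
  rewrite (pullback_mono j a7); apply/and3P; split.
  - exact: jouanolou_homog_nz.
  - exact: jouanolou_homog_nz.
  - exact: proportional_refl.
have [hf hA] := (represents_homog rf, represents_homog rA).
have /and3P[hpf hJ pf] := sf.
have [p [q [p0 q0 pb]]] := pullback_proportional jouanolou_homog
  (jouanolou_euler K) hf hA (represents_prop rf rA).
have [||g [a [j [a7 AE]]]] := @isotropy_mono A uA.
- have [[i nz] _] := homog_nzP _ hpf; exists i.
  apply: contraNneq nz => nz; apply/eqP/(mulfI p0).
  by rewrite pb nz !mulr0.
- apply/proportionalP => i l; apply: (mulfI q0); rewrite !mulrA -!pb -!mulrA.
  by congr (_ * _); move/proportionalP: pf.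
exists a, j; split; first exact: a7.
have hM := linear_triple_homog_nz (mono_unit j a7).
case/and3P: rA => h1 h2 h3; apply/and3P.
split; [exact: h1 | exact: hM |].
by apply: (proportional_trans h2 h3); rewrite AE proportional_scale.
Qed.

End Isotropy.

(** * The group of order 42 *)

Section Equivariance.
Variables (R : comNzRingType) (c : 'I_3 -> R) (j : 'I_3).
Hypotheses (c_sq : forall i, c (i + 1) ^+ 2 = c i) (c_det :
  c 0 * c 1 * c 2 = 1).
Implicit Types (u v w : 'I_3 -> R) (i : 'I_3).

(** The hypotheses on [c] make [quad] and [det3] equivariant under this monomial
    map; they hold for the coefficients a^(4^i) with a^7 = 1. *)
Definition twist u i := c i * u (i + j).

Lemma quad_twist u i : quad (twist u) i = twist (quad u) i.
Proof. by rewrite /quad /twist addrAC exprMn c_sq. Qed.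

Lemma polar_twist u w i : polar (twist u) (twist w) i = twist (polar u w) i.
Proof. by rewrite /polar /twist addrAC mulrACA -expr2 c_sq. Qed.

Lemma det3_twist u v w : det3 (twist u) (twist v) (twist w) = det3 u v w.
Proof.
rewrite -[RHS]mul1r -c_det !det3E /twist.
by elim/ord3_ind: (j); rewrite ?addr0 ?add0r ?ord3D; ring.
Qed.

Lemma invol_twist u i : invol (twist u) i = twist (invol u) i.
Proof.
have qE := funext (quad_twist u); have qqE := funext (quad_twist (quad u)).
have pE := funext (polar_twist u (quad u)).
by rewrite /invol /polar_det /iter_det qE qqE pE !det3_twist /twist; ring.
Qed.

End Equivariance.

Section Group.
Variable K : numFieldType.
Local Notation J := (jouanolou K).
Local Notation inv := (invol_cremona K).
Local Open Scope classical_set_scope.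
Implicit Types (A B : 'M[K]_3) (phi psi : cremona K) (a b : K) (i j k l : 'I_3).

Lemma invol_cremona2 : (inv * inv = 1)%g.
Proof. 
apply: (represents_inj (represents_mul (represents_invol K) (represents_invol
  K))
  (represents_id K)).
by have /and4P[_ _ /and3P[]] := invol_birational_pair K.
Qed.

Lemma invol_mono_comm a j phi : a ^+ 7 = 1 ->
  represents phi (linear_triple (monomial_mx a j)) -> (inv * phi = phi * inv)%g.
Proof.
move=> a7 rphi.
apply: (represents_inj (represents_mul (represents_invol K) rphi)
  (represents_mul rphi (represents_invol K))).
set f := comp_triple _ _; set g := comp_triple _ _.
suff -> : f = g by apply: proportional_refl.
apply: eq_from_tnth => i; rewrite !comp_tripleE invol_tripleE comp_invol.
rewrite linear_monoE comp_mpolyZ comp_mpolyXt invol_tripleE.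
pose c i : {mpoly K[3]} := (a ^+ (4 ^ i))%:MP.
have -> : tnth (linear_triple (monomial_mx a j)) = twist c j (@coords K).
  by apply: funext => l; rewrite linear_monoE /twist /c mul_mpolyC.
rewrite invol_twist /twist; [by rewrite mul_mpolyC | move=> l |]; rewrite /c.
  rewrite -rmorphXn exp4D // -exprM -mulnA; congr (_%:MP).
  have -> : (4 ^ l * (4 ^ 1%R * 2) = 7 * 4 ^ l + 4 ^ l)%N by rewrite expn1; lia.
  by rewrite exprD exprM a7 expr1n mul1r.
rewrite -!mpolyCM -!exprD; have ->
  : (4 ^ 0%R + 4 ^ 1%R + 4 ^ 2%R = 7 * 3)%N by [].
by rewrite exprM a7 expr1n.
Qed.

(** The involution fixes the three coordinate points, so it would be diagonal;
    but it sends (0, 1, 1) to (1, 0, -1). *)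
Lemma invol_nonlinear A phi : A \in unitmx ->
  represents phi (linear_triple A) ->
  inv <> phi.
Proof.
move=> uA rA invE; rewrite -invE in rA.
have /proportionalP par := represents_prop (represents_invol K) rA.
have parv (v : 'rV[K]_3) i l : invol (v ord0) i * (\sum_k A l k * v ord0 k)
    = invol (v ord0) l * (\sum_k A i k * v ord0 k).
  have := congr1 (fun p => eval_at p v) (par i l); rewrite /eval_at !mevalM.
  by rewrite -!/(eval_at _ v) -!eval_tripleE !linear_triple_eval !eval_invol.
have off i k : i != k -> A i k = 0.
  move=> ik; pose v : 'rV[K]_3 := delta_mx 0 k.
  have vE l : v ord0 l = (l == k)%:R by rewrite mxE eqxx.
  have iE l : invol (v ord0) l = - (l == k)%:R.
    rewrite /invol /polar_det /iter_det !det3E /polar /quad !ord3D !vE.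
    by elim/ord3_ind: (k); elim/ord3_ind: l; rewrite ?ord3D /=; ring.
  have := parv v k i; rewrite !iE eqxx (negPf ik) oppr0 mul0r mulN1r.
  rewrite (bigD1 k) //= vE eqxx mulr1 big1 ?addr0 => [/eqP|l lk]; last first.
    by rewrite vE (negPf lk) mulr0.
  by rewrite oppr_eq0 => /eqP.
have := parv (pt011 K) 0 1; have [_ _ -> -> _] := invol011 K.
rewrite mul0r !sum3 !mxE /= mulr0 !mulr1 add0r (off 1 2) // addr0 => /eqP.
rewrite mulf_eq0 pnatr_eq0 /= => /eqP A11; move: uA.
rewrite unitmxE (expand_det_row _ 1) big1 ?unitr0 // => k _.
have [<-|k1] := eqVneq 1 k; first by rewrite A11 mul0r.
by rewrite off ?mul0r.
Qed.

Lemma Iso_mul phi psi : Iso J phi -> Iso J psi -> Iso J (phi * psi)%g.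
Proof.
case/IsoP=> a [j [a7 ra]] /IsoP[b [l [b7 rb]]]; apply/IsoP.
exists (a * b ^+ (4 ^ j)), (j + l); split.
  by rewrite exprMn a7 -exprM mulnC exprM b7 expr1n mulr1.
by rewrite -(mono_mul a j l b7) -linear_triple_comp; apply: represents_mul.
Qed.

Lemma Iso_inv phi : Iso J phi -> Iso J phi^-1%g.
Proof.
case/IsoP=> a [j [a7 ra]]; apply/IsoP.
exists (mono_inv a j), (- j); split; first exact: mono_inv7.
have b7 := mono_inv7 j a7.
suff <- : linear_cremona (mono_unit (- j) b7) = phi^-1%g.
  exact: represents_linear.
have rV := represents_linear (mono_unit (- j) b7).
apply: (mulgI phi); rewrite mulgV.
apply: (represents_inj (represents_mul ra rV) (represents_id K)).
by rewrite linear_triple_comp mono_mulV // linear_triple1 proportional_refl.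
Qed.

Lemma Iso1 : Iso J 1%g.
Proof.
apply/IsoP; exists 1, 0; rewrite expr1n; split=> //.
by rewrite mono1 linear_triple1; apply: represents_id.
Qed.

Lemma Iso_invol_comm phi : Iso J phi -> (inv * phi = phi * inv)%g.
Proof. by case/IsoP=> a [j [a7 r]]; apply: invol_mono_comm r. Qed.

Definition inv_power (e : bool) : cremona K := if e then inv else 1%g.

(** The involution commutes with the isotropy group, so words in the generators
    can be sorted. *)
Lemma generatedE : generated ([set inv] `|` Iso J)
  = [set (inv_power ephi.1 * ephi.2)%g | ephi in [set ephi | Iso J ephi.2]].
Proof.
apply/seteqP; split.
  apply: smallest_sub; last first.
    move=> phi [->|iso]; first by exists (true, 1%g);
      [exact: Iso1 | rewrite mulg1].
    by exists (false, phi); rewrite //= mul1g.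
  split; first by exists (false, 1%g); [exact: Iso1 | rewrite mulg1].
  move=> _ _ [[e phi] /= iphi <-] [[e' psi] /= ipsi <-].
  have iV := Iso_inv ipsi.
  exists (e (+) e', phi * psi^-1)%g; first exact: Iso_mul.
  have invV : (inv^-1 = inv)%g by apply: (mulgI inv);
    rewrite mulgV invol_cremona2.
  have eV : ((inv_power e')^-1 = inv_power e')%g by case: e'; rewrite ?invg1.
  have c (f : bool) chi : Iso J chi ->
    (inv_power f * chi = chi * inv_power f)%g.
    by case: f => h; rewrite /= ?mulg1 ?mul1g // Iso_invol_comm.
  rewrite /= invgM eV -c // !mulgA -[(inv_power e * phi * _)%g]mulgA -c //
    mulgA.
  congr (_ * _ * _)%g; case: (e) (e') => [] [] /=;
    by rewrite ?mulg1 ?mul1g ?invol_cremona2.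
move=> _ [[e phi] /= iphi <-] S [[S1 Sdiv] sub].
have SV chi : S chi -> S chi^-1%g by move=> h; rewrite -[_^-1%g]mul1g;
  apply: Sdiv.
have SM chi psi : S chi -> S psi -> S (chi * psi)%g.
  by move=> h h'; rewrite -[psi]invgK; apply: Sdiv => //; apply: SV.
apply: SM; last by apply: sub; right.
by case: e => //; apply: sub; left.
Qed.

Lemma card_generated (z : K) : 7.-primitive_root z ->
  (generated ([set inv] `|` Iso J) #= `I_42)%card.
Proof.
move=> zP; have z7 (k : nat) : (z ^+ k) ^+ 7 = 1.
  by rewrite -exprM mulnC exprM (prim_expr_order zP) expr1n.
pose M (k : nat) j := linear_cremona (mono_unit j (z7 k)).
have rM (k : nat) j : represents (M k j) (linear_triple (monomial_mx (z ^+ k)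
  j)).
  exact: represents_linear.
pose g (t : bool * 'I_7 * 'I_3) := (inv_power t.1.1 * M t.1.2 t.2)%g.
have -> : generated ([set inv] `|` Iso J) = range g.
  rewrite generatedE; apply/seteqP;
    split=> [_ [[e phi] /= /IsoP[a [j [a7 r]]] <-]|].
    have [k aE] := prim_rootP zP a7; exists (e, k, j) => //; congr (_ * _)%g.
    apply: (represents_inj (rM k j) r); rewrite aE; exact: proportional_refl.
  move=> _ [[[e k] j] _ <-]; exists (e, M k j) => //=; apply/IsoP.
  by exists (z ^+ k), j.
have g_inj : injective g.
  have M_inj (k k' : nat) j j' : M k j = M k' j' -> z ^+ k = z ^+ k' /\ j = j'.
    move=> e; have r := rM k' j'; rewrite -e in r.
    exact: mono_inj (z7 k) (z7 k') (represents_prop (rM k j) r).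
  have M_isoM (k k' : nat) j j' : (inv * M k j)%g <> M k' j'.
    move=> /(canRL (mulgK _)) e.
    have : Iso J (M k' j' * (M k j)^-1)%g.
      apply: Iso_mul; last apply: Iso_inv; apply/IsoP.
        by exists (z ^+ k'), j'.
      by exists (z ^+ k), j.
    rewrite -e => -[[A uA rA] _]; exact: invol_nonlinear uA rA erefl.
  move=> [[e k] j] [[e' k'] j']; rewrite /g /=.
  have fin (m m' : 'I_7) l l' : M m l = M m' l' -> (m, l) = (m', l').
    case/M_inj=> /eqP; rewrite (eq_prim_root_expr zP) !modn_small // =>
      /eqP h ->.
    by congr (_, _); apply: val_inj.
  case: e; case: e' => /=; rewrite ?mul1g.
  - by move/mulgI/fin=> [-> ->].
  - by move/M_isoM.
  - by move/esym/M_isoM.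
  - by move/fin=> [-> ->].
have card42 : #|{: bool * 'I_7 * 'I_3}| = 42.
  by rewrite !card_prod card_bool !card_ord.
apply: card_eq_trans (inj_card_eq _) _; first by move=> x y _ _; apply: g_inj.
pose h (n : nat) : bool * 'I_7 * 'I_3 := nth (false, 0, 0) (enum {:
  bool * 'I_7 * 'I_3}) n.
have -> : [set: bool * 'I_7 * 'I_3] = h @` `I_42.
  apply/seteqP; split=> // x _; exists (index x (enum {: bool * 'I_7 * 'I_3})).
    suff : (index x (enum {: bool * 'I_7 * 'I_3}) < 42)%N by [].
    by rewrite -[X in (_ < X)%N]card42 cardE index_mem mem_enum.
  by rewrite /h nth_index // mem_enum.
apply: inj_card_eq => m n; rewrite !inE /= => lm ln /eqP.
by rewrite /h nth_uniq ?enum_uniq -?cardE ?card42 // => /eqP.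
Qed.

End Group.

(** * The group does not embed in the projective linear group *)

Section UnipotentMatrices.
Variable K : numFieldType.
Implicit Types (A T U : 'M[K]_3) (r : 'rV[K]_3).

Lemma det_mx33 A : \det A = A 0 0 * (A 1 1 * A 2 2 - A 1 2 * A 2 1)
  - A 0 1 * (A 1 0 * A 2 2 - A 1 2 * A 2 0)
  + A 0 2 * (A 1 0 * A 2 1 - A 1 1 * A 2 0).
Proof.
rewrite (expand_det_row _ 0) sum3 /cofactor.
rewrite !(expand_det_row _ (0 :
  'I_2)) !big_ord_recl !big_ord0 /cofactor !det_mx11 !mxE.
pose f m n := A (inord m) (inord n).
have AE i j : A i j = f i j by rewrite /f !inord_val.
rewrite !AE /= /bump /= !addn0 !expr0 expr1 expr2; ring.
Qed.

Lemma cayley3 A : 2 *: A ^+ 3 - (2 * \tr A) *: A ^+ 2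
  + (\tr A ^+ 2 - \tr (A ^+ 2)) *: A - (2 * \det A)%:M = 0.
Proof.
apply/matrixP => i j; rewrite !exprS expr0 !mulr1 -!mulmxE /mxtrace det_mx33.
do 4!rewrite ?mxE ?sum3.
elim/ord3_ind: i; elim/ord3_ind: j; rewrite /= ?mulr1n ?mulr0n; ring.
Qed.

(** T and T^2 have the same trace and the same determinant, which is 1, and 1 is
    an eigenvalue.  Evaluating the characteristic polynomial at 1 gives trace 0,
    whence T^3 = 1, or trace 3, whence T is unipotent of finite order. *)
Lemma square_conjugate_unipotent T U r : U \in unitmx -> T * U = U * T ^+ 2 ->
  T ^+ 7 = 1 -> r != 0 -> r *m T = r -> T = 1.
Proof.
move=> uU TU T7 r0 rT.
have TE : T = U * T ^+ 2 * invmx U by rewrite -TU -mulrA [U * _]mulmxV // mulr1.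
have trE : \tr (T ^+ 2) = \tr T by rewrite [in RHS]TE [RHS]mxtrace_mulC -mulmxE
  mulmxA mulVmx // mul1mx.
have d1 : \det T = 1.
  have dT : \det T * \det T = \det T * 1.
    have := congr1 determinant TU; rewrite !det_mulmx mulr1 mulrC => /mulfI.
    by rewrite -unitfE -unitmxE => /(_ uU) /esym.
  have d0 : \det T != 0.
    rewrite -unitfE -unitmxE -[_ \in _]/(T \is a GRing.unit).
    by rewrite -(@unitrX_pos _ T 7) // T7 unitr1.
  exact: (mulfI d0).
(* with both traces equal, the Cayley-Hamilton identity only involves tr T *)
have := cayley3 T; rewrite trE d1 mulr1 => ch.
have e2 : \tr T ^+ 2 = 3 * \tr T.
  have := congr1 (mulmx r) ch; rewrite mulmx0 mulmxBr mulmxDr mulmxBr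
    -!scalemxAr.
  rewrite mul_mx_scalar !exprS expr0 mulr1 -!mulmxE !mulmxA !rT.
  rewrite -scalerBl -scalerDl -scalerBl => /eqP;
    rewrite scaler_eq0 (negPf r0) orbF.
  by move=> /eqP h; apply/eqP; rewrite -subr_eq0 -h; apply/eqP; ring.
have two (X : 'M[K]_3) : 2 *: X = 0 -> X = 0.
  by move/eqP; rewrite scaler_eq0 pnatr_eq0 => /eqP.
have : \tr T * (\tr T - 3) = 0 by rewrite mulrBr -expr2 e2; ring.
move/eqP; rewrite mulf_eq0 subr_eq0 => /orP[] /eqP trT; rewrite {}trT in ch e2.
  have T3 : T ^+ 3 = 1.
    apply/eqP; rewrite -subr_eq0; apply/eqP/two; rewrite scalerBr -[RHS]ch.
    by rewrite mulr0 expr0n /= subr0 !scale0r subr0 addr0 -scalemx1.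
  by rewrite -T7 -[7%N]/(3 + 3 + 1)%N !exprD T3 !mul1r expr1.
(* trace 3: the entries of T^n are quadratic in n and have period 7 *)
apply/matrixP => i j; pose y n := (T ^+ n) i j.
have rec n : y (n + 3)%N = 3 * y (n + 2)%N - 3 * y (n + 1)%N + y n.
  have : (T ^+ n * _) i j = (T ^+ n * 0) i j := congr1 (fun X =>
    (T ^+ n * X) i j) ch.
  rewrite -scalemx1 !mulrDr !mulrN mulr0 -!scalerAr -!exprD.
  rewrite (mulr1 (T ^+ n) : T ^+ n * 1%:M = _) addn1 -exprSr !mxE -!/(y _) => h.
  have two0 : (2 : K) != 0 by rewrite pnatr_eq0.
  apply: (mulfI two0); apply/eqP; rewrite -subr_eq0 -[X in _ == X]h; apply/eqP.
  rewrite e2; ring.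
have y7 : y 7 = y 0 by rewrite /y T7.
have T8 : T ^+ 8 = T by rewrite exprSr T7 mul1r.
have y8 : y 8 = y 1%N by rewrite /y T8 expr1.
have := y8; have := y7.
rewrite (rec 5) (rec 4) (rec 3) (rec 2) (rec 1%N) (rec 0) => h7 h8.
have e5 : 21 * y 2 - 35 * y 1%N + 14 * y 0 = 0.
  by move/eqP: h7; rewrite -subr_eq0 => /eqP <-; ring.
have e7 : 28 * y 2 - 49 * y 1%N + 21 * y 0 = 0.
  by move/eqP: h8; rewrite -subr_eq0 => /eqP <-; ring.
have : 7 * (y 1%N - y 0) = 0.
  transitivity (4 * (21 * y 2 - 35 * y 1%N + 14 * y 0)
    - 3 * (28 * y 2 - 49 * y 1%N + 21 * y 0)); first by ring.
  by rewrite e5 e7 !mulr0 subrr.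
by move/eqP; rewrite mulf_eq0 pnatr_eq0 subr_eq0 => /eqP.
Qed.

End UnipotentMatrices.

Section NotLinear.
Variable K : numClosedFieldType.
Implicit Types (A T U X Y : 'M[K]_3) (r : 'rV[K]_3).

Lemma scaler_injl (V : lmodType K) (a b : K) (v : V) : v != 0 ->
  a *: v = b *: v -> a = b.
Proof.
move=> v0 /eqP; rewrite -subr_eq0 -scalerBl scaler_eq0 (negPf v0) orbF subr_eq0.
by move/eqP.
Qed.

Lemma unit_neq0 X : X \in unitmx -> X != 0.
Proof. by apply: contraTneq => ->; rewrite unitmxE det0 unitr0. Qed.

(** Matrices that commute up to a scalar [mu]: the square of A being scalar,
    mu^2 = 1, while the n-th power of T gives mu^n = 1 with n odd. *)
Lemma commute_of_odd_power A T n c t mu : A \in unitmx -> T \in unitmx ->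
  A ^+ 2 = c%:M -> T ^+ n = t%:M -> odd n -> A * T = mu *: (T * A) ->
    A * T = T * A.
Proof.
move=> uA uT A2 Tn nodd AT.
have AX k : A * T ^+ k = mu ^+ k *: (T ^+ k * A).
  elim: k => [|k IH]; first by rewrite !expr0 mulr1 mul1r scale1r.
  rewrite exprSr [A * _]mulrA IH -scalerAl -[T ^+ k * A * T]mulrA AT.
  by rewrite -scalerAr scalerA (exprSr mu) [T ^+ k * (T * A)]mulrA.
have mun : mu ^+ n = 1.
  have uTn : T ^+ n \in unitmx.
    by rewrite -[_ \in _]/(_ \is a GRing.unit) unitrX.
  apply: (@scaler_injl _ _ _ (T ^+ n * A)).
    by apply: unit_neq0; rewrite unitmx_mul uTn.
  by rewrite -AX scale1r Tn [LHS]scalar_mxC.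
have mu2 : mu ^+ 2 = 1.
  apply: (@scaler_injl _ _ _ (T * A ^+ 2)).
    apply: unit_neq0; rewrite unitmx_mul uT.
    by rewrite -[_ \in _]/(_ \is a GRing.unit) unitrX.
  have <- : A ^+ 2 * T = mu ^+ 2 *: (T * A ^+ 2).
    by rewrite !expr2 -mulrA AT -scalerAr [A * (T * A)]mulrA AT -scalerAl
      scalerA -mulrA.
  by rewrite scale1r A2 [RHS]scalar_mxC.
suff mu1 : mu = 1 by rewrite AT mu1 scale1r.
by rewrite -mun -(odd_double_half n) nodd add1n exprS -mul2n exprM mu2 expr1n
  mulr1.
Qed.

Lemma rank1_eigen X Y r : \rank X = 1%N -> r != 0 -> (r <= X)%MS ->
  X * Y = Y * X -> exists t, r *m Y = t *: r.
Proof.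
move=> X1 r0 rX XY; apply/sub_rVP.
have Xr : (X <= r)%MS.
  by have := mxrank_leqif_sup rX; rewrite X1 rank_rV r0 => -[_ /esym].
apply: submx_trans Xr; apply: submx_trans (submxMr Y rX) _.
by rewrite mulmxE XY -mulmxE submxMl.
Qed.

(** With s^2 = c the matrices A - s and A + s have product zero, so one of them
    has rank one; the matrices that commute with A preserve its row space. *)
Lemma common_eigenvector A T U c : A ^+ 2 = c%:M -> ~ (exists a, A = a%:M) ->
  A * T = T * A -> A * U = U * A ->
  exists r t u, [/\ r != 0, r *m T = t *: r & r *m U = u *: r].
Proof.
move=> A2 nscal AT AU; pose s := sqrtC c.
have key X : \rank X = 1%N -> X * T = T * X -> X * U = U * X ->
    exists r t u, [/\ r != 0, r *m T = t *: r & r *m U = u *: r].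
  move=> X1 XT XU; have X0 : X != 0 by rewrite -mxrank_eq0 X1.
  have r0 : nz_row X != 0 by rewrite nz_row_eq0.
  have [t rT] := rank1_eigen X1 r0 (nz_row_sub X) XT.
  have [u rU] := rank1_eigen X1 r0 (nz_row_sub X) XU.
  by exists (nz_row X), t, u.
have comm (a : K) X : A * X = X * A -> (A - a%:M) * X = X * (A - a%:M).
  by move=> AX; rewrite mulrBl mulrBr AX [X * a%:M]scalar_mxC.
have NM : (A - s%:M) *m (A - (- s)%:M) = 0.
  have SS : s%:M * s%:M = c%:M :> 'M[K]_3.
    by rewrite -[LHS]/(_ *m _) -scalar_mxM -expr2 sqrtCK.
  rewrite mulmxE raddfN opprK mulrBl !mulrDr SS -expr2 A2.
  by rewrite [A * s%:M]scalar_mxC [c%:M + _]addrC subrr.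
have := mulmx0_rank_max NM.
have rk (a : K) : (0 < \rank (A - a%:M)%R)%N.
  rewrite lt0n mxrank_eq0 subr_eq0; apply/eqP => e; apply: nscal.
  by exists a.
have [r1 _|r1 h] := eqVneq (\rank (A - s%:M)) 1%N.
  by apply: (key _ r1); apply: comm.
apply: (key (A - (- s)%:M)); try exact: comm.
have := rk s; have := rk (- s); move: r1 h.
by move: (\rank (A - _)) (\rank (A - _)) => m n; lia.
Qed.

(** Dividing T by its eigenvalue on the common eigenvector of T and U removes
    the scalars from the relations T^7 = 1 and T U = U T^2. *)
Lemma no_Z2_times_F21_in_PGL3 A T U c t0 u0 mu nu la :
  A \in unitmx -> T \in unitmx -> U \in unitmx ->
  A ^+ 2 = c%:M -> T ^+ 7 = t0%:M -> U ^+ 3 = u0%:M ->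
  A * T = mu *: (T * A) -> A * U = nu *: (U * A) ->
  T * U = la *: (U * T ^+ 2) -> (exists a, A = a%:M) \/ (exists t, T = t%:M).
Proof.
move=> uA uT uU A2 T7 U3 AT AU TU.
have {}AT := commute_of_odd_power uA uT A2 T7 isT AT.
have {}AU := commute_of_odd_power uA uU A2 U3 isT AU.
have [a|nscal] := pselect (exists a, A = a%:M); [by left | right].
have [r [t [u [r0 rT rU]]]] := common_eigenvector A2 nscal AT AU.
have eig_unit X x : X \in unitmx -> r *m X = x *: r -> x != 0.
  move=> uX rX; apply: contraNneq r0 => x0; move: rX; rewrite x0 scale0r => rX.
  by rewrite -[r](mulmxK uX) rX mul0mx.
have t_0 := eig_unit T t uT rT; have u_0 := eig_unit U u uU rU.
have lat : la * t = 1.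
  have := congr1 (mulmx r) TU; rewrite -scalemxAr expr2 -!mulmxE !mulmxA rT rU.
  rewrite -!scalemxAl rT rU -!scalemxAl rT !scalerA => /(scaler_injl r0) e.
  apply: (mulfI (mulf_neq0 t_0 u_0)); rewrite mulr1 [RHS]e; ring.
pose S := t^-1 *: T; exists t.
suff : S = 1.
  by rewrite /S => e; rewrite -[T](scalerK t_0) scalerA mulVf // scale1r
    -[LHS](scalerKV t_0) e scalemx1.
apply: (@square_conjugate_unipotent _ S U r) => //.
- rewrite /S exprZn -scalerAl TU scalerA -scalerAr; congr (_ *: _).
  by rewrite -[la](mulfK t_0) lat mul1r -expr2 exprVn.
- have rX k : r *m T ^+ k = t ^+ k *: r.
    elim: k => [|k IH]; first by rewrite !expr0 mulmx1 scale1r.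
    by rewrite exprSr -mulmxE mulmxA IH -scalemxAl rT scalerA -exprSr.
  have := rX 7; rewrite T7 mul_mx_scalar => /(scaler_injl r0) e.
  rewrite /S exprZn T7 e exprVn scale_scalar_mx mulVf ?expf_neq0 //.
- by rewrite /S -scalemxAr rT scalerA mulVf // scale1r.
Qed.

End NotLinear.

Section NotLinearizable.
Variable K : numClosedFieldType.
Local Notation J := (jouanolou K).
Local Notation inv := (invol_cremona K).
Local Open Scope classical_set_scope.
Implicit Types (A T U X Y : 'M[K]_3) (phi psi : cremona K).

Lemma represents_mulmx phi psi A B : represents phi (linear_triple A) ->
  represents psi (linear_triple B) ->
    represents (phi * psi)%g (linear_triple (A * B)).
Proof. by move=> rA rB; rewrite -mulmxE -linear_triple_comp;
  apply: represents_mul. Qed.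

Lemma represents_expmx phi A n : represents phi (linear_triple A) ->
  represents (phi ^+ n)%g (linear_triple (A ^+ n)).
Proof.
move=> rA; elim: n => [|n IH].
  by rewrite expg0 expr0 linear_triple1; apply: represents_id.
by rewrite expgS exprS; apply: represents_mulmx.
Qed.

Lemma represents_scale phi A B : B \in unitmx ->
  represents phi (linear_triple A) ->
  represents phi (linear_triple B) -> exists c, A = c *: B.
Proof. by move=> uB rA rB; apply:
  proportional_linear (represents_prop rA rB). Qed.

Lemma represents_eq1 phi a : represents phi (linear_triple (a%:M :
  'M[K]_3)) -> phi = 1%g.
Proof.
move=> r; apply: (represents_inj r (represents_id K)); rewrite -linear_triple1.
by have := proportional_scale a (1%:M : 'M[K]_3); rewrite scalemx1.
Qed.

Lemma not_linearizable z : 7.-primitive_root (z : K) ->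
  ~ linearizable (generated ([set inv] `|` Iso J)).
Proof.
move=> zP [h lin]; have z7 := prim_expr_order zP.
have one7 : (1 : K) ^+ 7 = 1 by rewrite expr1n.
pose tau := linear_cremona (mono_unit 0 z7).
pose sig := linear_cremona (mono_unit 1 one7).
have rtau : represents tau (linear_triple (monomial_mx z 0)) by apply:
  represents_linear.
have rsig : represents sig (linear_triple (monomial_mx 1 1)) by apply:
  represents_linear.
have isot : Iso J tau by apply/IsoP; exists z, 0.
have isos : Iso J sig by apply/IsoP; exists 1, 1.
have G phi : ([set inv] `|` Iso J) phi -> Aut_plane (phi ^ h)%g.
  by move=> Sphi; apply: lin; exists phi => //; apply: sub_gen_smallest.
have [A uA rA] := G inv (or_introl erefl).
have [T uT rT] := G tau (or_intror isot).
have [U uU rU] := G sig (or_intror isos).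
have u1 : (1%:M : 'M[K]_3) \in unitmx by apply: unitmx1.
have r1 : represents (1%g : cremona K) (linear_triple (1%:M : 'M[K]_3)).
  by rewrite linear_triple1; apply: represents_id.
have pow1 phi X n : (phi ^+ n = 1)%g ->
  represents (phi ^ h)%g (linear_triple X) ->
    exists c : K, X ^+ n = c%:M.
  move=> e rX; have := represents_expmx n rX; rewrite -conjXg e conj1g => r.
  by have [c ->] := represents_scale u1 r r1; exists c; rewrite scalemx1.
have tau7 : (tau ^+ 7 = 1)%g.
  apply: (represents_inj (represents_expmx 7%N rtau) r1).
  suff -> : monomial_mx z 0 ^+ 7 = 1%:M by apply: proportional_refl.
  suff zk k : monomial_mx z 0 ^+ k = monomial_mx (z ^+ k) 0 by rewrite zk z7
    mono1.
  elim: k => [|k IH]; first by rewrite !expr0 mono1.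
  by rewrite exprSr IH -mulmxE mono_mul // addr0 expr1 exprSr.
have sig3 : (sig ^+ 3 = 1)%g.
  apply: (represents_inj (represents_expmx 3%N rsig) r1).
  suff -> : monomial_mx (1 : K) 1 ^+ 3 = 1%:M by apply: proportional_refl.
  rewrite !exprS expr0 mulr1 -!mulmxE !mono_mul ?expr1n ?mulr1 // !ord3D.
  by rewrite expr1n mulr1 mono1.
have rel : (tau * sig = sig * tau ^+ 2)%g.
  apply: (represents_inj (represents_mulmx rtau rsig)
    (represents_mulmx rsig (represents_expmx 2%N rtau))).
  suff -> : monomial_mx z 0 * monomial_mx 1 1 = monomial_mx 1 1 * monomial_mx z
    0 ^+ 2 by apply: proportional_refl.
  have z14 : (z * z) ^+ 7 = 1 by rewrite exprMn z7 mulr1.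
  rewrite expr2 -!mulmxE !mono_mul ?expr1n // ?mulr1 ?mul1r ?expr1 //.
  rewrite addr0 add0r addr0 -expr2 -exprM; congr (monomial_mx _ _).
  rewrite -[RHS]/(z ^+ (7 + 1)%N) exprD z7 mul1r expr1 //.
have [c A2] := pow1 inv A 2%N (invol_cremona2 K) rA.
have [t0 T7] := pow1 tau T 7%N tau7 rT.
have [u0 U3] := pow1 sig U 3%N sig3 rU.
have commJ phi : Iso J phi -> (inv ^ h * phi ^ h = phi ^ h * inv ^ h)%g.
  by move=> iphi; rewrite -!conjMg (Iso_invol_comm iphi).
have [mu AT] : exists mu, A * T = mu *: (T * A).
  apply: represents_scale (represents_mulmx rA rT) _;
    first by rewrite unitmx_mul uT.
  by rewrite (commJ tau isot); apply: (represents_mulmx rT rA).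
have [nu AU] : exists nu, A * U = nu *: (U * A).
  apply: represents_scale (represents_mulmx rA rU) _;
    first by rewrite unitmx_mul uU.
  by rewrite (commJ sig isos); apply: (represents_mulmx rU rA).
have [la TU] : exists la, T * U = la *: (U * T ^+ 2).
  apply: represents_scale (represents_mulmx rT rU) _.
    by rewrite unitmx_mul uU -[_ \in _]/(_ \is a GRing.unit) unitrX.
  have -> : (tau ^ h * sig ^ h = sig ^ h * (tau ^ h) ^+ 2)%g.
    by rewrite -conjXg -!conjMg rel.
  exact: (represents_mulmx rU (represents_expmx 2%N rT)).
case: (no_Z2_times_F21_in_PGL3 uA uT uU A2 T7 U3 AT AU TU) => -[a aE].
  rewrite aE in rA; have /(canRL (conjgK h)) := represents_eq1 rA.
  rewrite conj1g => inv1; apply: (invol_nonlinear u1 r1); exact: inv1.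
rewrite aE in rT; have /(canRL (conjgK h)) := represents_eq1 rT.
rewrite conj1g => tau1; rewrite tau1 in rtau.
have := represents_prop rtau r1; rewrite -mono1 => /(mono_inj z7 one7)[z1 _].
have := prim_order_dvd zP 1; rewrite expr1 z1 eqxx //.
Qed.

End NotLinearizable.

(** * Forms of low degree and seventh roots of unity *)

Section HomogeneousForms.
Variable K : fieldType.
Local Notation mpoly := {mpoly K[3]}.
Implicit Types p : mpoly.

Lemma homogS_split p d : p \is d.+1.-homog ->
  exists q : 'I_3 -> mpoly,
    (forall i, q i \is d.-homog) /\ p = \sum_i 'X_i * q i.
Proof.
move=> /dhomogP hp; rewrite (mpolyE p) big_seq.
apply: (@big_ind _ (fun p => exists q : 'I_3 -> mpoly,
    (forall i, q i \is d.-homog) /\ p = \sum_i 'X_i * q i)).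
- exists (fun=> 0); split; first by move=> i; apply: rpred0.
  by rewrite big1 // => i _; rewrite mulr0.
- move=> _ _ [q [hq ->]] [q' [hq' ->]]; exists (fun i => q i + q' i).
  split; first by move=> i; apply: rpredD.
  by rewrite -big_split; apply: eq_bigr => i _; rewrite mulrDr.
move=> m /hp; rewrite -[_ m]/(mdeg m) => mdm.
have [i mi] : exists i, m i != 0%N.
  apply/existsP; apply: contra_eqT mdm => /existsPn m0.
  by rewrite mdegE big1 // => i _; have := m0 i; rewrite negbK => /eqP.
have Um : (U_(i) <= m)%MM by rewrite lep1mP.
exists (fun j => if j == i then p@_m *: 'X_[m - U_(i)] else 0); split.
  move=> j; case: ifP => _; last exact: rpred0.
  apply: rpredZ; rewrite dhomogX /=; apply/eqP.
  have := congr1 mdeg (submK Um); rewrite mdegD mdeg1 mdm; lia.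
rewrite (bigD1 i) //= eqxx big1 ?addr0 => [|j ji]; last first.
  by rewrite (negPf ji) mulr0.
by rewrite -scalerAr -mpolyXD addmC submK.
Qed.

Lemma homog0_const p : p \is 0.-homog -> exists c, p = c%:MP.
Proof.
move=> /dhomogP hp; rewrite (mpolyE p) big_seq.
apply: (@big_ind _ (fun p => exists c, p = c%:MP)).
- by exists 0; rewrite mpolyC0.
- by move=> _ _ [c ->] [c' ->]; exists (c + c'); rewrite mpolyCD.
move=> m /hp /eqP; rewrite -[_ m]/(mdeg m) mdeg_eq0 => /eqP ->; exists p@_0.
by rewrite mpolyX0 -mul_mpolyC mulr1.
Qed.

Lemma linear_form p : p \is 1.-homog ->
  exists c : 'I_3 -> K, p = \sum_i 'X_i * (c i)%:MP.
Proof.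
case/homogS_split=> q [hq ->].
have [c cE] := fin_all_exists (fun i => homog0_const (hq i)).
by exists c; apply: eq_bigr => i _; rewrite cE.
Qed.

Lemma quadratic_form p : p \is 2.-homog ->
  exists c : 'I_3 -> 'I_3 -> K, p = \sum_i 'X_i * \sum_j 'X_j * (c i j)%:MP.
Proof.
case/homogS_split=> q [hq ->].
have [c cE] := fin_all_exists (fun i => linear_form (hq i)).
by exists c; apply: eq_bigr => i _; rewrite cE.
Qed.

Lemma cubic_form p : p \is 3.-homog ->
  exists c : 'I_3 -> 'I_3 -> 'I_3 -> K,
    p = \sum_i 'X_i * \sum_j 'X_j * \sum_k 'X_k * (c i j k)%:MP.
Proof.
case/homogS_split=> q [hq ->].
have [c cE] := fin_all_exists (fun i => quadratic_form (hq i)).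
by exists c; apply: eq_bigr => i _; rewrite cE.
Qed.

End HomogeneousForms.

Section RootsOfUnity.
Variable K : numClosedFieldType.
Implicit Types x y w z : K.

Lemma unity7_exists : exists z : K, 7.-primitive_root z.
Proof.
pose p : {poly K} := 'X^7 - 1; have [r Dp] := closed_field_poly_normal p.
rewrite (monicP _) ?monicXnsubC // scale1r in Dp.
have rn1 : all 7.-unity_root r by apply/allP=> z; rewrite -root_prod_XsubC -Dp.
have sz_r : (7 < (size r).+1)%N.
  by rewrite -(size_prod_XsubC r id) -Dp size_XnsubC.
have [|z _ zP] := hasP (@cyclic.has_prim_root _ 7 r isT rn1 _ sz_r);
  last by exists z.
by rewrite -separable.separable_prod_XsubC -Dp cyclotomic.separable_Xn_sub_1 //
  pnatr_eq0.
Qed.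

Lemma unity7_conj x : x ^+ 7 = 1 -> x * x^* = 1.
Proof.
move=> x7; rewrite -normCK; have : `|x| ^+ 7 = 1 by rewrite -normrX x7 normr1.
by move/eqP; rewrite pexpr_eq1 // => /eqP ->; rewrite expr1n.
Qed.

(** If x + y + w = 0, conjugation gives xy + yw + wx = 0, since the conjugates
    are the inverses.  Then x, y, w are the roots of X^3 - xyw, and x^3 = y^3
    together with x^7 = y^7 forces x = y. *)
Lemma unity7_sum3 x y w : x ^+ 7 = 1 -> y ^+ 7 = 1 -> w ^+ 7 = 1 -> x != y ->
  x + y + w != 0.
Proof.
move=> x7 y7 w7; apply: contraNneq => s0.
have [[xx yy] ww] := (unity7_conj x7, unity7_conj y7, unity7_conj w7).
have p0 : x * y + y * w + w * x = 0.
  have c0 : x^* + y^* + w^* = 0 by rewrite -!rmorphD s0 rmorph0.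
  transitivity (x * y * w * (x^* + y^* + w^*)); last by rewrite c0 mulr0.
  transitivity (x * y * (w * w^*) + y * w * (x * x^*) + w * x * (y * y^*)).
    by rewrite xx yy ww !mulr1.
  by ring.
have cube : x ^+ 3 = y ^+ 3.
  apply/eqP; rewrite -subr_eq0; apply/eqP.
  transitivity ((x - y) * ((x + y + w) ^+ 2 - (x * y + y * w + w * x)
    - (x + y + w) * w)); last by rewrite s0 p0; ring.
  by ring.
have six : x ^+ 6 = y ^+ 6 by rewrite -[6%N]/(3 * 2)%N !exprM cube.
have x60 : x ^+ 6 != 0.
  by apply: contra_eq_neq x7 => x0; rewrite exprS x0 mulr0 eq_sym oner_eq0.
by apply/eqP/(mulfI x60); rewrite -exprSr x7 six -exprSr y7.
Qed.

(** The coefficient below the leading one is, up to sign and the leading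
    coefficient, the sum of the roots. *)
Lemma gapped_poly_eq0 (p : {poly K}) (rs : seq K) : uniq rs ->
  all (root p) rs ->
  (size p <= (size rs).+1)%N -> size rs != 0%N -> p`_(size rs).-1 = 0 ->
  \sum_(x <- rs) x != 0 -> p = 0.
Proof.
move=> urs rts szp rs0 gap sum0; apply/eqP/negPn/negP => p0.
have sz : size p = (size rs).+1.
  by apply/eqP; rewrite eqn_leq szp max_poly_roots.
have pE := all_roots_prod_XsubC sz rts; rewrite uniq_rootsE in pE.
have := gap; rewrite (pE urs) coefZ coefPn_prod_XsubC // => /eqP.
by rewrite mulf_eq0 lead_coef_eq0 (negPf p0) oppr_eq0 (negPf sum0).
Qed.

End RootsOfUnity.

(** * The singular points and the Geiser involution *)

Section Geiser.
Variable K : numClosedFieldType.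
Variables (z : K) (zP : 7.-primitive_root z).
Local Notation J := (jouanolou K).
Implicit Types (v p : 'rV[K]_3) (C : {mpoly K[3]}) (i : 'I_7) (k : 'I_3).

(** The singular points lie on the curve (1 : t^3 : t), at t^7 = 1. *)
Definition curve_pt (t : K) : 'rV[K]_3 := \row_i t ^+ nth 0%N [:: 0; 3; 1]%N i.
Definition sing_pt (i : 'I_7) := curve_pt (z ^+ i).

Let z7 := prim_expr_order zP.

Lemma curve_ptE t : [/\ curve_pt t ord0 0 = 1, curve_pt t ord0 1 = t ^+ 3 &
  curve_pt t ord0 2 = t].
Proof. by rewrite !mxE /= expr0 expr1. Qed.

Lemma curve_pt_neq0 t : curve_pt t != 0.
Proof.
apply/eqP => /rowP/(_ 0)/eqP; have [e _ _] := curve_ptE t.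
by rewrite -[0]/ord0 e mxE oner_eq0.
Qed.

Lemma root7 (i : 'I_7) : (z ^+ i) ^+ 7 = 1.
Proof. by rewrite -exprM mulnC exprM z7 expr1n. Qed.

Lemma sing_pt_singular (i : 'I_7) : eval_triple J (sing_pt i) = 0.
Proof.
apply/rowP => k; rewrite eval_jouanolou [RHS]mxE /cross /quad.
have [e0 e1 e2] := curve_ptE (z ^+ i); have t7 := root7 i.
rewrite -/(sing_pt i) in e0 e1 e2; set t := z ^+ i in e0 e1 e2 t7.
have key : (t ^+ 3) ^+ 2 * t = 1 by rewrite -exprM -exprSr t7.
have key' : t ^+ 3 * t ^+ 3 ^+ 2 = t ^+ 2.
  by rewrite -exprM -exprD -[(3 + 3 * 2)%N]/(7 + 2)%N exprD t7 mul1r.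
elim/ord3_ind: k; rewrite !ord3D e0 e1 e2.
- by rewrite expr1n mul1r -exprSr subrr.
- by rewrite key expr1n mulr1 subrr.
- by rewrite mulr1 mulrC key' subrr.
Qed.

(** No coordinate of a singular point is zero; with t = z / x the first equation
    gives y = x t^3 and the second one t^7 = 1. *)
Lemma singular_is_sing_pt v : v != 0 -> eval_triple J v = 0 ->
  exists i : 'I_7, (v == sing_pt i)%MS.
Proof.
move=> v0 w0; have w k : cross (quad (v ord0)) (v ord0) k = 0.
  by rewrite -eval_jouanolou w0 mxE.
have := w 0; have := w 1; have := w 2; rewrite /cross /quad !ord3D.
set a := v ord0 0; set b := v ord0 1; set c := v ord0 2.
move=> /eqP; rewrite subr_eq0 => /eqP h2 /eqP; rewrite subr_eq0 => /eqP h1.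
move=> /eqP; rewrite subr_eq0 => /eqP h0.
have a0 : a != 0.
  apply: contraNneq v0 => a0; rewrite a0 in h0 h1 h2.
  have c0 : c = 0.
    have : c ^+ 3 = 0 by rewrite exprSr h0 expr0n mul0r.
    by move/eqP; rewrite expf_eq0 => /eqP.
  rewrite c0 in h2; have b0 : b = 0.
    have : b ^+ 3 = 0 by rewrite exprSr h2 expr0n mul0r.
    by move/eqP; rewrite expf_eq0 => /eqP.
  by apply/eqP/rowP; elim/ord3_ind; rewrite mxE.
pose t := c / a; have cE : c = a * t by rewrite mulrC divfK.
have bE : b = a * t ^+ 3.
  apply: (mulfI (expf_neq0 2 a0)); rewrite -h0 cE; ring.
have t7 : t ^+ 7 = 1.
  apply: (mulfI (expf_neq0 3 a0)); rewrite mulr1.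
  by transitivity (b ^+ 2 * c); [rewrite bE cE; ring | rewrite -h1; ring].
have [i tE] := prim_rootP zP t7; exists i.
apply: (@eqmx_scale _ _ _ a) => // k; rewrite /sing_pt -tE.
have [e0 e1 e2] := curve_ptE t.
by elim/ord3_ind: k; rewrite -/a -/b -/c ?e0 ?e1 ?e2 ?mulr1.
Qed.

Lemma sum_three (s : seq 'I_7) : uniq s -> size s = 3 ->
  \sum_(x <- [seq z ^+ (val i) | i <- s]) x != 0.
Proof.
case: s => [|i [|j [|k [|]]]] //= /andP[];
  rewrite inE negb_or => /andP[ij _] _ _.
rewrite !big_cons big_nil addr0 addrA; apply: unity7_sum3; rewrite ?root7 //.
by rewrite (eq_prim_root_expr zP) !modn_small.
Qed.

(** The sum is the opposite of the missing seventh root. *)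
Lemma sum_six (s : seq 'I_7) : uniq s -> size s = 6 ->
  \sum_(x <- [seq z ^+ (val i) | i <- s]) x != 0.
Proof.
move=> us sz6; rewrite big_map big_uniq //=.
have /cards1P[j jE] : #|[set i | i \notin s]| == 1%N.
  have -> : [set i | i \notin s] = ~: [set i in s].
    by apply/setP => i; rewrite !inE.
  have := cardsC [set i in s]; rewrite cardsE (card_uniqP us) sz6 card_ord.
  by move/(@addnI 6 _ 1) => ->.
have tot : \sum_(i < 7) z ^+ i = 0.
  have z1 : z - 1 != 0.
    by rewrite subr_eq0 -[z]expr1 -(prim_order_dvd zP).
  by apply: (mulfI z1); rewrite mulr0 -subrX1 z7 subrr.
have := tot; rewrite (bigID (mem s)) /= [X in _ + X](eq_bigl (fun i =>
  i \in [set j])); last first.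
  by move=> i; rewrite -jE inE.
rewrite big_set1 => /eqP; rewrite addr_eq0 => /eqP e; rewrite [X in X != 0]e.
by rewrite oppr_eq0 expf_eq0 (prim_root_eq0 zP) andbF.
Qed.

Lemma roots_uniq (s : seq 'I_7) : uniq s -> uniq [seq z ^+ (val i) | i <- s].
Proof.
move=> us; rewrite map_inj_uniq // => i j /eqP.
by rewrite (eq_prim_root_expr zP) !modn_small ?ltn_ord // => /eqP/val_inj.
Qed.

Lemma take_enum_zeros C n : (n < #|[pred i :
  'I_7 | eval_at C (sing_pt i) == 0%R]|)%N ->
  exists s : seq 'I_7, [/\ uniq s, size s = n.+1 &
    forall i, i \in s -> eval_at C (sing_pt i) = 0].
Proof.
set A := [pred i | _]; move=> ltn.
exists (take n.+1 (enum A)); split.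
- by rewrite take_uniq ?enum_uniq.
- by rewrite size_takel // -cardE.
- by move=> i /mem_take; rewrite mem_enum => /eqP.
Qed.

Lemma curve_root (p : {poly K}) C (s : seq 'I_7) :
  (forall t, p.[t] = eval_at C (curve_pt t)) ->
  (forall i, i \in s -> eval_at C (sing_pt i) = 0) ->
  all (root p) [seq z ^+ (val i) | i <- s].
Proof.
move=> pE s0; apply/allP => _ /mapP[i si ->]; apply/rootP.
by rewrite pE s0.
Qed.

(** On the curve (1, t^3, t) a line has the exponents 0, 1, 3 and a conic the
    exponents 0, 1, 2, 3, 4, 6: the exponents 2 and 5 are missing. *)
Lemma general_position_sing : general_position sing_pt.
Proof.
split; first by move=> i; apply: curve_pt_neq0.
- move=> L L0 /linear_form[c LE]; rewrite leqNgt;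
  apply/negP => /take_enum_zeros[s [us sz s0]].
  pose p := Poly [:: c 0; c 2; 0; c 1].
  have pE t : p.[t] = eval_at L (curve_pt t).
    have [e0 e1 e2] := curve_ptE t.
    rewrite /eval_at LE sum3 !mevalD !mevalM !mevalXU !mevalC e0 e1 e2
      horner_Poly /=; ring.
  have p0 : p = 0.
    apply: (gapped_poly_eq0 (roots_uniq us) (curve_root pE s0));
      rewrite ?size_map ?sz //.
    - exact: size_Poly.
    - by rewrite coef_Poly.
    - exact: sum_three.
  have cE (n : nat) : [:: c 0; c 2; 0;
    c 1]`_n = 0 by rewrite -coef_Poly -/p p0 coef0.
  case/eqP: L0; rewrite LE sum3 (cE 0%N : c 0 = 0) (cE 1%N :
    c 2 = 0) (cE 3%N : c 1 = 0).
  by rewrite mpolyC0 !mulr0 !addr0.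
- move=> C C0 /quadratic_form[c CE]; rewrite leqNgt;
  apply/negP => /take_enum_zeros[s [us sz s0]].
  pose cs := [:: c 0 0; c 0 2 + c 2 0; c 2 2; c 0 1 + c 1 0; c 1 2 + c 2 1; 0;
    c 1 1].
  pose p := Poly cs.
  have pE t : p.[t] = eval_at C (curve_pt t).
    have [e0 e1 e2] := curve_ptE t.
    rewrite /eval_at CE !sum3 !(mevalD, mevalM, mevalXU,
      mevalC) e0 e1 e2 horner_Poly /=; ring.
  have p0 : p = 0.
    apply: (gapped_poly_eq0 (roots_uniq us) (curve_root pE s0));
      rewrite ?size_map ?sz //.
    - exact: size_Poly.
    - by rewrite coef_Poly.
    - exact: sum_six.
  have cE (n : nat) : cs`_n = 0 by rewrite -coef_Poly -/p p0 coef0.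
  have sum0 (x y : K) : x + y = 0 -> y%:MP = - x%:MP :> {mpoly K[3]}.
    by move/eqP; rewrite addrC addr_eq0 => /eqP ->; rewrite mpolyCN.
  case/eqP: C0; rewrite CE !sum3 (cE 0%N : c 0 0 = 0) (cE 2%N :
    c 2 2 = 0) (cE 6%N : c 1 1 = 0).
  rewrite (sum0 _ _ (cE 1%N)) (sum0 _ _ (cE 3%N)) (sum0 _ _ (cE 4%N)) mpolyC0;
    ring.
Qed.

(** Modulo t^7 = 1 the ten cubic monomials take the seven exponents, three of
    them twice; a cubic vanishing at all seventh roots of unity is thus a
    combination of the three differences, which are the coefficients of the
    form. *)
Lemma cubics_through_sing C : C \is 3.-homog ->
  (forall i : 'I_7, eval_at C (sing_pt i) = 0) ->
  exists a : 'I_3 -> K, forall v,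
    eval_at C v = \sum_i a i * eval_triple J v ord0 i.
Proof.
move=> /cubic_form[c CE] C0.
pose cs := [:: c 0 0 0 + (c 1 1 2 + c 1 2 1 + c 2 1 1);
  c 0 0 2 + c 0 2 0 + c 2 0 0; c 1 1 1 + (c 0 2 2 + c 2 0 2 + c 2 2 0);
  c 2 2 2 + (c 0 0 1 + c 0 1 0 + c 1 0 0);
  c 0 1 2 + c 0 2 1 + c 1 0 2 + c 1 2 0 + c 2 0 1 + c 2 1 0;
  c 1 2 2 + c 2 1 2 + c 2 2 1; c 0 1 1 + c 1 0 1 + c 1 1 0].
pose p := Poly cs.
have pE t : t ^+ 7 = 1 -> p.[t] = eval_at C (curve_pt t).
  move=> t7; have [e0 e1 e2] := curve_ptE t.
  rewrite /eval_at CE !sum3 !(mevalD, mevalM, mevalXU,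
    mevalC) e0 e1 e2 horner_Poly /=.
  apply/esym/eqP; rewrite -subr_eq0; apply/eqP.
  transitivity ((t ^+ 7 - 1) * (c 1 1 2 + c 1 2 1 + c 2 1 1 + c 1 1 1 * t ^+
    2)).
    ring.
  by rewrite t7 subrr mul0r.
have p0 : p = 0.
  apply: (@roots_geq_poly_eq0 _ p [seq z ^+ (val i) | i <- enum 'I_7]).
  - apply/allP => _ /mapP[i _ ->]; apply/rootP; rewrite pE ?root7 //; exact: C0.
  - by apply: roots_uniq; apply: enum_uniq.
  - by rewrite size_map size_enum_ord; apply: size_Poly.
have cE (n : nat) : cs`_n = 0 by rewrite -coef_Poly -/p p0 coef0.
exists (fun k => if k == 0 then c 2 2 2 else if k == 1 then c 0 0 0 else c 1 1
  1).
move=> v; rewrite /eval_at CE !sum3 !(mevalD, mevalM, mevalXU,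
  mevalC) /= !eval_jouanolou.
rewrite /cross /quad !ord3D.
set x := v ord0 0; set y := v ord0 1; set w := v ord0 2.
set rhs := (X in _ = X).
transitivity (rhs + cs`_0 * (y ^+ 2 * w) + cs`_1 * (x ^+ 2 * w) + cs`_2 * (x *
  w ^+ 2)
  + cs`_3 * (x ^+ 2 * y) + cs`_4 * (x * y * w) + cs`_5 * (y * w ^+ 2)
  + cs`_6 * (x * y ^+ 2)); first by rewrite /rhs /=; ring.
by rewrite !cE !mul0r !addr0.
Qed.

(** The pencil through the seven points and p consists of the combinations of
    the coefficients of the form that vanish at p;
      they all vanish at v iff the form
    at v is zero or proportional to the form at p. *)
Lemma Geiser_associated (I : cremona K) :
  is_associated_involution J I -> is_Geiser_involution sing_pt I.
Proof.
case=> H [H0 hH HP]; split; first exact: general_position_sing.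
exists H; split=> // p p0 /(HP p p0)[p' [mapI pp' tgt]].
have p'0 : p' != 0.
  case: mapI => f [_ f0 /eqmxP fp']; by rewrite -mxrank_eq0 -fp' mxrank_eq0.
have [_ wp0 _] : tangent_at J (eval_triple J p) p.
  by apply/tgt => //; left; rewrite submx_refl.
have [_ wp'0 _] : tangent_at J (eval_triple J p) p'.
  by apply/tgt => //; right; rewrite submx_refl.
have wscale v u : (v == u)%MS -> exists c, eval_triple J v = c *:
  eval_triple J u.
  move=> /andP[/sub_rVP[c ->] _]; exists (c ^+ 3); apply/rowP => k.
  by rewrite [RHS]mxE !eval_jouanolou /cross /quad !mxE; ring.
exists p'; split=> //.
  move=> i; split; apply/negP; rewrite andbC => /wscale[c];
    by rewrite sing_pt_singular scaler0 => w; rewrite w eqxx in wp0 wp'0.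
move=> v v0; split=> [base|on C hC C0 Cp].
  have [w0|w0] := eqVneq (eval_triple J v) 0.
    by left; apply: singular_is_sing_pt.
  right; apply/tgt => //; split=> //; apply/eqmx_rowP => // l j.
  pose wi (k : 'I_3) : {mpoly K[3]} := tnth (jouanolou_form K) k.
  (* the cubic of the pencil that compares the coordinates l and j *)
  pose C := eval_triple J p ord0 j *: wi l - eval_triple J p ord0 l *: wi j.
  have CE u : eval_at C u = eval_triple J p ord0 j * eval_triple J u ord0 l
      - eval_triple J p ord0 l * eval_triple J u ord0 j.
    by rewrite /eval_at mevalB !mevalZ -!/(eval_at _ u) -!eval_tripleE.
  have : eval_at C v = 0.
    apply: base.
    - by apply: rpredB; apply: rpredZ; apply: jouanolou_homog.
    - by move=> k; rewrite CE sing_pt_singular !mxE !mulr0 subrr.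
    - by rewrite CE; ring.
  by rewrite CE => /eqP; rewrite subr_eq0 => /eqP e; rewrite mulrC e mulrC.
have [a CE] := cubics_through_sing hC C0.
suff [c wE] : exists c, eval_triple J v = c *: eval_triple J p.
  transitivity (c * eval_at C p); last by rewrite Cp mulr0.
  rewrite !CE mulr_sumr; apply: eq_bigr => k _.
  by rewrite wE mxE mulrCA.
case: on => [[i /wscale[c]]|/(tgt v v0)[_ _ /andP[/sub_rVP[c ->] _]]].
  by rewrite sing_pt_singular scaler0 => ->; exists 0; rewrite scale0r.
by exists c.
Qed.

End Geiser.

(** * The degree of the foliation *)

Section Degree.
Variable K : numClosedFieldType.
Variables (z : K) (zP : 7.-primitive_root z).
Local Notation J := (jouanolou K).
Implicit Types (v l : 'rV[K]_3).

Lemma cross_pairs (u w : 'I_3 -> K) : (forall k, cross u w k = 0) ->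
  forall i j, u i * w j = u j * w i.
Proof.
move=> c0; have := (c0 0, c0 1, c0 2); rewrite /cross !ord3D => -[[]].
move=> /eqP; rewrite subr_eq0 => /eqP h0 /eqP; rewrite subr_eq0 => /eqP h1.
move=> /eqP; rewrite subr_eq0 => /eqP h2.
by elim/ord3_ind => //; elim/ord3_ind.
Qed.

Lemma tangent_atP l v : (forall i, \sum_k sing_pt z i ord0 k * l ord0 k != 0) ->
  v != 0 -> tangent_at J l v <->
  \sum_k v ord0 k * l ord0 k = 0 /\ \sum_k quad (v ord0) k * l ord0 k = 0.
Proof.
move=> off v0; split; first exact: tangent_at_det.
case=> lv lq; have l0 : l != 0.
  apply: contraNneq (off ord0) => ->; rewrite big1 // => k _.
  by rewrite [X in _ * X]mxE mulr0.
have w0 : eval_triple J v != 0.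
  apply/eqP => /(singular_is_sing_pt zP v0)[i /andP[_ /sub_rVP[c e]]].
  case/eqP: (off i); rewrite e.
  under eq_bigr do rewrite mxE -mulrA.
  by rewrite -mulr_sumr lv mulr0.
split=> //; apply/eqmx_rowP => //; apply: cross_pairs => k.
transitivity (v ord0 k * (\sum_k quad (v ord0) k * l ord0 k)
  - quad (v ord0) k * (\sum_k v ord0 k * l ord0 k)); last first.
  by rewrite lv lq !mulr0 subrr.
rewrite /cross !eval_jouanolou !sum3 /cross.
by elim/ord3_ind: k; rewrite !ord3D; ring.
Qed.

Local Notation a := ('X_0 : {mpoly K[3]}).
Local Notation b := ('X_1 : {mpoly K[3]}).
Local Notation c := ('X_2 : {mpoly K[3]}).

(** Up to a square, the discriminant of the tangency equation of the line with
    coefficients (a, b, c). *)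
Definition klein_quartic : {mpoly K[3]} := a * c ^+ 3 + b ^+ 3 * c + a ^+ 3 * b.
(** The coefficient of x^2 in the tangency equation of a line with coefficients
    (a, b, c), after elimination of z. *)
Definition leading : {mpoly K[3]} := c ^+ 3 + a ^+ 2 * b.
Definition dual_line (i : 'I_7) : {mpoly K[3]} :=
  \sum_k sing_pt z i ord0 k *: 'X_k.

Lemma klein_homog : klein_quartic \is 4.-homog.
Proof.
have hX := @coords_homog K.
apply: rpredD; first apply: rpredD.
- exact: (dhomogM (hX 0) (dhomogMn 3 (hX 2))).
- exact: (dhomogM (dhomogMn 3 (hX 1)) (hX 2)).
- exact: (dhomogM (dhomogMn 3 (hX 0)) (hX 1)).
Qed.

Lemma leading_homog : leading \is 3.-homog.
Proof.
have hX := @coords_homog K.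
apply: rpredD; first exact: (dhomogMn 3 (hX 2)).
exact: (dhomogM (dhomogMn 2 (hX 0)) (hX 1)).
Qed.

Lemma dual_lines_homog : \prod_i dual_line i \is 7.-homog.
Proof.
suff : \prod_i dual_line i \is (\sum_(i < 7) 1).-homog.
  by rewrite sum1_card card_ord.
apply: (big_ind2 (fun p d => p \is d.-homog)) => //; first exact: dhomog1.
  by move=> p d q e hp hq; apply: dhomogM.
by move=> i _; apply: rpred_sum => k _; apply: rpredZ; apply: coords_homog.
Qed.

Definition pt3 (x y w : K) : 'rV[K]_3 := \row_k nth 0 [:: x; y; w] k.

Lemma pt3E x y w : [/\ pt3 x y w ord0 0 = x, pt3 x y w ord0 1 = y &
  pt3 x y w ord0 2 = w].
Proof. by rewrite !mxE. Qed.

Lemma neq0_eval (p : {mpoly K[3]}) v : eval_at p v != 0 -> p != 0.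
Proof. by apply: contraNneq => ->; rewrite /eval_at meval0. Qed.

Lemma degree_locus_neq0 : c * leading * klein_quartic * \prod_i dual_line i !=
  0.
Proof.
have [e0 e1 e2] := pt3E 0 0 1; have [f0 f1 f2] := pt3E 1 1 0.
rewrite !mulf_neq0 //.
- by apply: (@neq0_eval _ (pt3 0 0 1)); rewrite /eval_at mevalXU e2 oner_eq0.
- apply: (@neq0_eval _ (pt3 0 0 1));
  rewrite /eval_at !(mevalD, rmorphXn, mevalM) /= !mevalXU.
  by rewrite e0 e1 e2 mulr0 addr0 expr1n oner_eq0.
- apply: (@neq0_eval _ (pt3 1 1 0));
  rewrite /eval_at !(mevalD, rmorphXn, mevalM) /= !mevalXU.
  by rewrite f0 f1 f2 !expr1n expr0n /= !mulr0 !add0r mulr1 oner_eq0.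
apply/prodf_neq0 => i _; apply: (@neq0_eval _ (pt3 1 0 0)).
have [g0 g1 g2] := pt3E 1 0 0; have [h0 _ _] := curve_ptE (z ^+ i).
rewrite /eval_at raddf_sum sum3 /= !mevalZ !mevalXU g0 g1 g2 !mulr0 !addr0
  mulr1.
by rewrite /sing_pt h0 oner_eq0.
Qed.

(** On the line a x + b y + c z = 0 the conic a y^2 + b z^2 + c x^2 = 0 becomes
    al x^2 + 2 be x y + ga y^2 = 0, with be^2 - al ga equal to - c^2 times the
    Klein quartic. *)
Theorem jouanolou_degree : has_degree J 2.
Proof.
exists (c * leading * klein_quartic * \prod_i dual_line i); split.
- exact: degree_locus_neq0.
- exists (1 + 3 + 4 + 7)%N; apply: dhomogM dual_lines_homog;
  apply: dhomogM klein_homog.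
  by apply: dhomogM leading_homog; apply: (@coords_homog K 2).
move=> l l0; rewrite /eval_at !mevalM rmorph_prod !mulf_eq0 !negb_or.
case/andP=> /andP[/andP[c0 al0] kl0] /prodf_neq0 lines.
have off i : \sum_k sing_pt z i ord0 k * l ord0 k != 0.
  have := lines i isT; rewrite /= raddf_sum /=.
  by under eq_bigr do rewrite mevalZ mevalXU.
rewrite mevalXU in c0.
rewrite /leading !(mevalD, rmorphXn, mevalM) /= !mevalXU in al0.
rewrite /klein_quartic !(mevalD, rmorphXn, mevalM) /= !mevalXU in kl0.
set A := l ord0 0 in al0 kl0; set B := l ord0 1 in al0 kl0.
set C := l ord0 2 in c0 al0 kl0.
set al := C ^+ 3 + A ^+ 2 * B in al0; pose be := A * B ^+ 2.
pose ga := A * C ^+ 2 + B ^+ 3.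
pose de := sqrtC (be ^+ 2 - al * ga); have de2 : de ^+ 2 = be ^+ 2 - al * ga.
  exact: sqrtCK.
have de0 : de != 0.
  suff : de ^+ 2 != 0 by rewrite expf_eq0.
  rewrite de2.
  have -> : be ^+ 2 - al * ga = - (C ^+ 2 * (A * C ^+ 3 + B ^+ 3 * C + A ^+ 3 *
    B)).
    by rewrite /be /al /ga; ring.
  by rewrite oppr_eq0 mulf_neq0 ?expf_neq0.
(* x = (s - be) y / al, and z is given by the line; denominators cleared *)
pose pt s := pt3 (C * (s - be)) (C * al) (- (A * (s - be) + B * al)).
have pt0 s : pt s != 0.
  apply/eqP => /rowP/(_ 1)/eqP; have [_ e _] := pt3E (C * (s - be)) (C * al) (-
    (A * (s - be) + B * al)).
  by rewrite -[0 in X in X -> _]/ord0 e mxE mulf_eq0 (negPf c0) (negPf al0).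
have ptl s : \sum_k pt s ord0 k * l ord0 k = 0.
  have [e0 e1 e2] := pt3E (C * (s - be)) (C * al) (- (A * (s - be) + B * al)).
  by rewrite sum3 e0 e1 e2 -/A -/B -/C; ring.
have ptq s : s ^+ 2 = de ^+ 2 -> \sum_k quad (pt s ord0) k * l ord0 k = 0.
  have [e0 e1 e2] := pt3E (C * (s - be)) (C * al) (- (A * (s - be) + B * al)).
  move=> s2; rewrite sum3 /quad !ord3D e0 e1 e2 -/A -/B -/C.
  transitivity (al * (s ^+ 2 - (be ^+ 2 - al * ga))).
    by rewrite /al /be /ga; ring.
  by rewrite s2 de2 subrr mulr0.
pose s (i : 'I_2) := (-1) ^+ i * de.
have s2 i : s i ^+ 2 = de ^+ 2 by rewrite /s exprMn sqrr_sign mul1r.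
exists (fun i => pt (s i)); split=> [//|i j /eqmx_rowP|v v0].
  move=> /(_ (pt0 _) (pt0 _)) par; have := par 0 1.
  have [e0 e1 _] := pt3E (C * (s i - be)) (C * al) (- (A * (s i - be) + B *
    al)).
  have [f0 f1 _] := pt3E (C * (s j - be)) (C * al) (- (A * (s j - be) + B *
    al)).
  rewrite e0 e1 f0 f1 [RHS]mulrC =>
    /(mulIf (mulf_neq0 c0 al0))/(mulfI c0)/addIr.
  move/(mulIf de0); case: i j {par e0 e1 f0 f1} => [[|[|//]] ?] [[|[|//]] ?] /=.
  - by move=> _; apply: val_inj.
  - by move/eqP; rewrite expr0 expr1 -subr_eq0 opprK (pnatr_eq0 _ 2).
  - by move/eqP; rewrite expr0 expr1 eq_sym -subr_eq0 opprK (pnatr_eq0 _ 2).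
  - by move=> _; apply: val_inj.
rewrite tangent_atP //; split=> [[lv lq]|[i /andP[/sub_rVP[k vE] _]]];
  last first.
  split; rewrite vE.
    by under eq_bigr do rewrite mxE -mulrA; rewrite -mulr_sumr ptl mulr0.
  transitivity (k ^+ 2 * (\sum_k quad (pt (s i) ord0) k * l ord0 k)).
    rewrite mulr_sumr; apply: eq_bigr => j _; rewrite /quad mxE; ring.
  by rewrite ptq ?mulr0.
rewrite !sum3 -/A -/B -/C in lv lq; rewrite /quad !ord3D in lq.
set x := v ord0 0 in lv lq; set y := v ord0 1 in lv lq;
  set w := v ord0 2 in lv lq.
have root : (al * x + be * y - de * y) * (al * x + be * y + de * y) = 0.
  transitivity ((al * x + be * y) ^+ 2 - de ^+ 2 * y ^+ 2); first by ring.
  rewrite de2; transitivity (al * (C ^+ 2 * (y ^+ 2 * A + w ^+ 2 * B + x ^+ 2 *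
    C))
    - al * B * (x * A + y * B + w * C) * (w * C - x * A - y * B)).
    by rewrite /al /be /ga; ring.
  by rewrite lv lq !(mulr0, mul0r) subrr.
have found i : al * x + be * y = s i * y -> (v == pt (s i))%MS.
  move=> xE; apply: (@eqmx_scale _ _ _ (y / (C * al))) => // k.
  have Cal0 := mulf_neq0 c0 al0.
  have [e0 e1 e2] := pt3E (C * (s i - be)) (C * al) (- (A * (s i - be) + B *
    al)).
  apply: (mulfI Cal0); rewrite mulrA [X in _ = X * _]mulrC divfK //.
  elim/ord3_ind: k; rewrite ?e0 ?e1 ?e2 -/x -/y -/w.
  - transitivity (C * (s i * y - be * y)); last by ring.
    by rewrite -xE; ring.
  - by ring.
  - transitivity (al * (w * C)); first by ring.
    transitivity (al * (- (x * A + y * B))).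
      congr (_ * _).
      transitivity (x * A + y * B + w * C - (x * A + y * B)); first by ring.
      by rewrite lv sub0r.
    transitivity (- (A * (s i * y - be * y) + B * al * y)); last by ring.
    by rewrite -xE; ring.
move/eqP: root; rewrite mulf_eq0 => /orP[] /eqP root.
  exists 0; apply: found; rewrite /s expr0 mul1r.
  by apply/eqP; rewrite -subr_eq0; apply/eqP.
exists 1; apply: found; rewrite /s expr1 mulN1r mulNr.
by apply/eqP; rewrite -addr_eq0; apply/eqP.
Qed.

End Degree.

Local Open Scope classical_set_scope.

Theorem proposition3p10 (R : realType) :
  let FJ := jouanolou R[i] in
  has_degree FJ 2 /\
  (exists! I : cremona R[i], is_associated_involution FJ I) /\
  forall I : cremona R[i], is_associated_involution FJ I ->
    let G := generated ([set I] `|` Iso FJ) in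
    [/\ Geiser_type I, (G #= `I_42)%card & ~ linearizable G].
Proof.
move=> FJ; have [z zP] := unity7_exists R[i].
have assoc := invol_associated R[i].
split; first exact: jouanolou_degree zP.
split; first by exists (invol_cremona R[i]); split=> // I;
  apply: associated_uniq.
move=> I hI G; rewrite {}/G -(associated_uniq assoc hI); split.
- exists 1%g, (sing_pt z); rewrite conjg1.
  exact: Geiser_associated zP _ assoc.
- exact: card_generated zP.
- exact: not_linearizable zP.
Qed.
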